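(* Let $K\subset\mathbb R^n$ be a full-dimensional compact convex body with barycenter $0$, $\operatorname{int}(K)\cap\mathbb Z^n=\{0\}$, and $\operatorname{vol}(K)=(n+1)^n/n!$. Then $w_u(K)\ge n+1$ for every primitive $u\in\mathbb Z^n$. Moreover, for the centered standard simplex $S_n$, one has $w_u(S_n)\ge n+1$ for every primitive $u\in\mathbb Z^n$, with equality for $u=e_i$ ($1\le i\le n$) and for $u=(1,\dots,1)$.
   Context: For a nonzero $u\in\mathbb Z^n$, the lattice width of $K$ in direction $u$ is $w_u(K)=\max_{x\in K}\langle u,x\rangle-\min_{x\in K}\langle u,x\rangle$. The centered standard simplex is $S_n=(n+1)\Delta_n-(1,\dots,1)$, where $\Delta_n=\operatorname{conv}\{0,e_1,\dots,e_n\}$ and $e_1,\dots,e_n$ is the standard basis of $\mathbb R^n$. The barycenter of $K$ is $\frac1{\operatorname{vol}(K)}\int_Ky\,dy$. *)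

(* Defs.v *)
From HB Require Import structures.
From mathcomp Require Import all_boot all_order all_algebra.
From mathcomp Require Import all_classical all_reals all_analysis.

Set Implicit Arguments.
Unset Strict Implicit.
Unset Printing Implicit Defensive.

Import Order.TTheory GRing.Theory Num.Theory.
Import numFieldNormedType.Exports.

Local Open Scope classical_set_scope.
Local Open Scope ring_scope.

Definition rV_display : measure_display.
Proof. exact: default_measure_display. Qed.

Section measurable_rV.
Context {R : realType} {n : nat}.

Let coord (i : 'I_n) (x : 'rV[R]_n) : measurableTypeR R := x 0 i.

Let rV_set0 : g_sigma_preimage coord set0.
Proof. exact: sigma_algebra0. Qed.

Let rV_setC A : g_sigma_preimage coord A -> g_sigma_preimage coord (~` A).
Proof. exact: sigma_algebraC. Qed.

Let rV_bigcup (F : (set 'rV[R]_n)^nat) :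
  (forall i, g_sigma_preimage coord (F i)) ->
  g_sigma_preimage coord (\bigcup_i F i).
Proof. exact: sigma_algebra_bigcup. Qed.

(* The product sigma-algebra, generated by the coordinate functions; it is
   the Borel sigma-algebra of R^n. *)
HB.instance Definition _ := @isMeasurable.Build rV_display 'rV[R]_n
  (g_sigma_preimage coord) rV_set0 rV_setC rV_bigcup.

Lemma measurable_coord (i : 'I_n) :
  measurable_fun [set: 'rV[R]_n] (fun x => x 0 i : measurableTypeR R).
Proof.
move=> _ Y mY; rewrite setTI; apply: sub_sigma_algebra => /=.
rewrite -bigcup_seq/=; exists i => /=; first by rewrite mem_index_enum.
by exists Y => //; rewrite setTI.
Qed.

Lemma measurable_fun_coord d (T : measurableType d) (f : T -> 'rV[R]_n) :
  (forall i, measurable_fun [set: T] (fun x => f x 0 i : measurableTypeR R)) ->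
  measurable_fun [set: T] f.
Proof.
move=> mf _ A mA; rewrite setTI.
pose G : set (set 'rV[R]_n) := [set A | measurable (f @^-1` A)].
suff H : g_sigma_preimage coord `<=` G by exact: H.
apply: smallest_sub.
  split => [|B GB|F GF]; rewrite /G/=.
  - by rewrite preimage_set0.
  - by rewrite setTD preimage_setC; exact: measurableC.
  - by rewrite preimage_bigcup; exact: bigcupT_measurable.
move=> B; rewrite -bigcup_seq/= => -[i _ [C mC <-]].
by rewrite /G/= setTI -[X in measurable X]setTI; exact: mf.
Qed.

End measurable_rV.

Section lebesgue_rV.
Context {R : realType}.
Local Open Scope ereal_scope.

Section step.
Context {n : nat}.
Variable mu : {sigma_finite_measure set 'rV[R]_n -> \bar R}.

Definition rV_cons (p : measurableTypeR R * 'rV[R]_n) : 'rV[R]_n.+1 :=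
  row_mx (p.1)%:M p.2.

Definition rV_uncons (x : 'rV[R]_n.+1) : measurableTypeR R * 'rV[R]_n :=
  (x 0%R 0%R, rsubmx (x : 'rV[R]_(1 + n))).

Lemma rV_cons0 p : rV_cons p 0%R ord0 = p.1.
Proof.
rewrite (_ : ord0 = lshift n (0%R : 'I_1)); last exact: val_inj.
by apply: etrans (row_mxEl _ _ _ _) _; rewrite mxE.
Qed.

Lemma rV_consS p i : rV_cons p 0%R (lift ord0 i) = p.2 0%R i.
Proof.
rewrite (_ : lift ord0 i = rshift 1 i); last exact: val_inj.
exact: row_mxEr.
Qed.

Lemma rV_consK : cancel rV_cons rV_uncons.
Proof.
move=> [a v]; rewrite /rV_uncons {2}/rV_cons row_mxKr; congr pair.
exact: rV_cons0.
Qed.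

Lemma measurable_rV_cons : measurable_fun setT rV_cons.
Proof.
apply: measurable_fun_coord => i; have [j ->|->] := unliftP ord0 i.
- under eq_fun do rewrite rV_consS.
  exact: (measurableT_comp (measurable_coord j) measurable_snd).
- by under eq_fun do rewrite rV_cons0; exact: measurable_fst.
Qed.

Lemma measurable_rV_uncons : measurable_fun setT rV_uncons.
Proof.
apply: measurable_fun_pair; first exact: measurable_coord.
apply: measurable_fun_coord => i.
by under eq_fun do rewrite mxE; exact: measurable_coord.
Qed.

(* Fubini's description of the Lebesgue measure of R^(n+1) = R * R^n. *)
Definition lebesgue_rV_step : set 'rV[R]_n.+1 -> \bar R :=
  pushforward (@lebesgue_measure R \x mu) rV_cons.

HB.instance Definition _ := Measure.copy lebesgue_rV_step
  (measure_function_pushforward__canonical__measure_function_Measure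
     (@lebesgue_measure R \x mu) measurable_rV_cons).

Let preimage_rV_uncons_cons (B : set (measurableTypeR R * 'rV[R]_n)) :
  rV_cons @^-1` (rV_uncons @^-1` B) = B.
Proof. by apply/seteqP; split => p /=; rewrite rV_consK. Qed.

Let lebesgue_rV_step_sigma_finite : sigma_finite setT lebesgue_rV_step.
Proof.
have /sigma_finiteP[F [TF ndF Foo]] := sigma_finiteT (@lebesgue_measure R).
have /sigma_finiteP[G [TG ndG Goo]] := sigma_finiteT mu.
exists (fun k => rV_uncons @^-1` (F k `*` G k)).
  rewrite -preimage_bigcup (_ : \bigcup_k _ = setT) ?preimage_setT//.
  rewrite -subTset => -[x y] _.
  have [i _ Fx] : (\bigcup_i F i) x by rewrite -TF.
  have [j _ Gy] : (\bigcup_i G i) y by rewrite -TG.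
  exists (maxn i j) => //; split => /=.
  - by move: x Fx; exact/subsetPset/ndF/leq_maxl.
  - by move: y Gy; exact/subsetPset/ndG/leq_maxr.
move=> k; have [mF Fk] := Foo k; have [mG Gk] := Goo k; split.
  rewrite -[X in measurable X]setTI.
  by apply: measurable_rV_uncons => //; exact: measurableX.
rewrite /lebesgue_rV_step /pushforward preimage_rV_uncons_cons.
by rewrite product_measure1E// lte_mul_pinfty// ge0_fin_numE.
Qed.

HB.instance Definition _ := Measure_isSigmaFinite.Build _ _ _
  lebesgue_rV_step lebesgue_rV_step_sigma_finite.

End step.

Fixpoint lebesgue_rV (n : nat) : {sigma_finite_measure set 'rV[R]_n -> \bar R} :=
  match n with
  | 0 => dirac (0%R : 'rV[R]_0)
  | n'.+1 => lebesgue_rV_step (lebesgue_rV n')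
  end.

Lemma measurable_box (n : nat) (A : 'I_n -> set (measurableTypeR R)) :
  (forall i, measurable (A i)) ->
  measurable [set x : 'rV[R]_n | forall i, A i (x 0%R i)].
Proof.
move=> mA; pose B i := (fun x : 'rV[R]_n => x 0%R i) @^-1` A i.
rewrite (_ : [set x | _] = \bigcap_(i in [set: 'I_n]) B i); last first.
  by apply/seteqP; split => [x Ax i _|x Bx i]; [exact: Ax|exact: Bx].
apply: fin_bigcap_measurable => // i _.
by rewrite -[X in measurable X]setTI; exact: measurable_coord.
Qed.

Lemma lebesgue_rV_box (n : nat) (A : 'I_n -> set (measurableTypeR R)) :
  (forall i, measurable (A i)) ->
  lebesgue_rV n [set x | forall i, A i (x 0%R i)] =
    \prod_(i < n) lebesgue_measure (A i).
Proof.
elim: n A => [|n IHn] A mA /=.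
  by rewrite big_ord0 diracE mem_set//= => -[].
rewrite big_ord_recl -IHn => [|i]; last exact: mA.
rewrite -product_measure1E//; last first.
  by apply: (@measurable_box n (fun i => A (lift ord0 i))).
rewrite /lebesgue_rV_step /pushforward; congr (_ _).
apply/seteqP; split => p /=.
  by move=> Ap; split => /= [|i]; rewrite -?rV_cons0 -?rV_consS; exact: Ap.
case=> /= A0 AS i; have [j ->|->] := unliftP ord0 i.
- by rewrite rV_consS; exact: AS.
- by rewrite rV_cons0.
Qed.

End lebesgue_rV.

Section convex_bodies.
Context {R : realType} {n : nat}.
Implicit Types (K : set 'rV[R]_n) (u : 'rV[int]_n) (x : 'rV[R]_n).

Definition barycenter K : 'rV[R]_n :=
  (fine (lebesgue_rV n K))^-1 *:
    \row_i (\int[lebesgue_rV n]_(y in K) (y 0 i))%R.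

Definition integer_points : set 'rV[R]_n :=
  range (map_mx intr : 'rV[int]_n -> 'rV[R]_n).

Definition pairing u x : R := \sum_(i < n) (u 0 i)%:~R * x 0 i.

(* On a nonempty compact K both extrema are attained, so that [sup] and [inf]
   are the maximum and the minimum. *)
Definition lattice_width u K : R :=
  sup [set pairing u x | x in K] - inf [set pairing u x | x in K].

Definition primitive u : Prop := \big[gcdn/0%N]_(i < n) `|u 0%R i|%N = 1%N.

Definition convex_hull K : set 'rV[R]_n := smallest (@convex_set R 'rV[R]_n) K.

Definition standard_simplex : set 'rV[R]_n :=
  convex_hull ([set 0] `|` range (fun i : 'I_n => delta_mx 0 i)).

Definition centered_simplex : set 'rV[R]_n :=
  [set n.+1%:R *: x - const_mx 1 | x in standard_simplex].

End convex_bodies.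

Arguments integer_points : clear implicits.
Arguments centered_simplex : clear implicits.

(* Main.v *)
Require Import Defs.
From mathcomp Require Import all_boot all_order all_algebra.
From mathcomp Require Import all_classical all_reals all_analysis.
Import Order.TTheory GRing.Theory Num.Theory.
Import numFieldNormedType.Exports.
Local Open Scope classical_set_scope.
Local Open Scope ring_scope.
From mathcomp Require Import finfield measurable_realfun ring lra zify.
Set Implicit Arguments.
Unset Strict Implicit.
Unset Printing Implicit Defensive.

(** The volume hypothesis is the extremal case of a bound, and a small lattice
    width would make that bound strict. Fix a grid [P] of the lattice points
    [m] with [m / M] in [K], let [N] be their number, and work over the field
    with [p] elements, for a prime [p] much larger than [M]. Order [P] by an
    injective linear form, and call depth of a point the least degree of a
    polynomial that is nonzero at this point and zero at the preceding ones.

    Upper bound on depths ([sum_depth_le], [grid_rigid]). By duality, a point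
    [v] of depth [o] is the last element in the support of a function [c_v] on
    [P] that is orthogonal to all polynomials of degree less than [o]: the
    Laurent polynomial [f_v] with coefficients [c_v] vanishes to order [o] at
    (1, ..., 1). Let [F] be the product of the [f_v], each raised to the power
    [a]. Being congruent modulo [p] to a given vector is a polynomial condition
    of degree [n (p - 1)], so if [F] vanishes to higher order, then the sum of
    its coefficients over any class of exponents modulo [p] is zero. The leading
    coefficient of [F] is nonzero, and its exponent is [a] times the sum of [P],
    which is small because the barycenter of [K] is 0. The exponents of [F] lie
    in [a N M K]; if [p] is slightly larger than [a N M], another exponent in
    the class of the leading one would give a nonzero lattice point in the
    interior of [K]. So the leading coefficient is alone in its class, which is
    a contradiction. Hence the sum of the depths is at most [n (p - 1) / a],
    that is, about [n N M].

    Lower bound on depths ([card_depth_le], [sum_depth_ge]). Polynomials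
    witnessing distinct points are linearly independent on [P], so the number
    of points of depth at most [d] is at most the dimension of the space of
    polynomials of degree at most [d] restricted to [P]. If the linear form [u]
    takes at most [L + 1] values on [P], that space is spanned by the monomials
    whose exponent in [u] is at most [L], and there are
    ['C(n + d, n) - 'C(n + d - L - 1, n)] of them. With [L] about [w M], where
    [w] is the width of [K], sum over [d] up to [(n + 1) M].

    Since [N] is about [V M ^ n] for the volume [V] of [K] ([grid_volume]),
    the two bounds give, in the limit ([width_volume_eps]),
    [(n + 1) V + (n + 1 - w) ^ (n + 1) / (n + 1)! <= n V + (n + 1) ^ (n + 1) / (n + 1)!]
    if [w < n + 1]. For [V = (n + 1) ^ n / n!] the last term is [V], and the
    inequality fails. The asymptotics of the grid are Riemann sums, which need
    the boundary of [K] to be null ([convex_boundary_null]). *)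

(** * Polynomial functions over a field *)

(** A monomial is the list of its factors, not an exponent vector: its degree
    is the size of the list, and inductions peel off one factor at a time. *)
Definition mono {F : fieldType} {n : nat} (s : seq 'I_n) (y : 'rV[F]_n) : F :=
  \prod_(i <- s) y 0 i.

(** The degree bound is strict, so that [poly_lt 0] holds of the zero
    function only; truncated subtraction of degrees is then harmless in
    [poly_lt_conv]. *)
Inductive poly_lt {F : fieldType} {n : nat} (D : nat) : ('rV[F]_n -> F) -> Prop :=
| poly_lt0 : poly_lt D (fun=> 0)
| poly_ltDmono c s f : (size s < D)%N -> poly_lt D f ->
    poly_lt D (fun y => c * mono s y + f y).

Section poly_lt_theory.
Context {F : fieldType} {n : nat}.
Implicit Types (f g : 'rV[F]_n -> F) (y : 'rV[F]_n).

Lemma poly_lt_eq D f g : poly_lt D f -> f =1 g -> poly_lt D g.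
Proof. by move=> pf /funext<-. Qed.

Lemma poly_lt_mono D c s : (size s < D)%N ->
  poly_lt D (fun y : 'rV[F]_n => c * mono s y).
Proof.
move=> sD; apply: (poly_lt_eq (poly_ltDmono c sD (poly_lt0 D))) => y.
by rewrite addr0.
Qed.

Lemma poly_lt_cst D c : poly_lt D.+1 (fun _ : 'rV[F]_n => c).
Proof.
apply: (poly_lt_eq (poly_lt_mono c (s := [::]) (ltn0Sn D))) => y.
by rewrite /mono big_nil mulr1.
Qed.

Lemma poly_lt0E f : poly_lt 0 f -> f =1 fun=> 0.
Proof. by elim=> // c s h; rewrite ltn0. Qed.

Lemma poly_ltD D f g : poly_lt D f -> poly_lt D g ->
  poly_lt D (fun y => f y + g y).
Proof.
move=> pf pg; elim: pf => [|c s h sD _ IH].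
  by apply: (poly_lt_eq pg) => y; rewrite add0r.
by apply: (poly_lt_eq (poly_ltDmono c sD IH)) => y; rewrite addrA.
Qed.

Lemma poly_ltZ D f c : poly_lt D f -> poly_lt D (fun y => c * f y).
Proof.
elim=> [|b s h sD _ IH].
  by apply: (poly_lt_eq (poly_lt0 D)) => y; rewrite mulr0.
by apply: (poly_lt_eq (poly_ltDmono (c * b) sD IH)) => y; rewrite mulrDr mulrA.
Qed.

Lemma poly_lt_sum D (J : Type) (r : seq J) (P : pred J) (h : J -> 'rV[F]_n -> F) :
  (forall j, P j -> poly_lt D (h j)) -> poly_lt D (fun y => \sum_(j <- r | P j) h j y).
Proof.
move=> ph; elim: r => [|j r IH].
  by apply: (poly_lt_eq (poly_lt0 D)) => y; rewrite big_nil.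
have [Pj|Pj] := boolP (P j).
  by apply: (poly_lt_eq (poly_ltD (ph j Pj) IH)) => y; rewrite big_cons Pj.
by apply: (poly_lt_eq IH) => y; rewrite big_cons (negbTE Pj).
Qed.

Lemma poly_ltW D E f : (D <= E)%N -> poly_lt D f -> poly_lt E f.
Proof.
move=> DE; elim=> [|c s h sD _ IH]; first exact: poly_lt0.
by apply: poly_ltDmono => //; exact: leq_trans DE.
Qed.

Lemma poly_lt_coordM D f i : poly_lt D f -> poly_lt D.+1 (fun y => y 0 i * f y).
Proof.
elim=> [|c s h sD _ IH].
  by apply: (poly_lt_eq (poly_lt0 _)) => y; rewrite mulr0.
have sD' : (size (i :: s) < D.+1)%N by [].
apply: (poly_lt_eq (poly_ltDmono c sD' IH)) => y.
by rewrite /mono big_cons mulrDr mulrCA.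
Qed.

Lemma poly_ltM D E f g : poly_lt D.+1 f -> poly_lt E.+1 g ->
  poly_lt (D + E).+1 (fun y => f y * g y).
Proof.
move=> pf pg; elim: pf => [|c s h sD _ IH].
  by apply: (poly_lt_eq (poly_lt0 _)) => y; rewrite mul0r.
suff ps : poly_lt (size s + E).+1 (fun y => mono s y * g y).
  have ps' := poly_ltZ c ps.
  have sED : ((size s + E).+1 <= (D + E).+1)%N by rewrite ltnS leq_add2r.
  apply: (poly_lt_eq (poly_ltD (poly_ltW sED ps') IH)) => y.
  by rewrite mulrDl mulrA.
elim: s {c sD} => [|i s IHs].
  by apply: (poly_lt_eq pg) => y; rewrite /mono big_nil mul1r.
by apply: (poly_lt_eq (poly_lt_coordM i IHs)) => y; rewrite /mono big_cons mulrA.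
Qed.

Lemma poly_ltX D f k : poly_lt D.+1 f -> poly_lt (k * D).+1 (fun y => f y ^+ k).
Proof.
move=> pf; elim: k => [|k IH].
  by apply: (poly_lt_eq (poly_lt_cst _ 1)) => y; rewrite expr0.
by apply: (poly_lt_eq (poly_ltM pf IH)) => y; rewrite exprS.
Qed.

Lemma poly_lt_prod D (r : seq 'I_n) (h : 'I_n -> 'rV[F]_n -> F) :
  (forall i, poly_lt D.+1 (h i)) ->
  poly_lt (size r * D).+1 (fun y => \prod_(i <- r) h i y).
Proof.
move=> ph; elim: r => [|i r IH].
  by apply: (poly_lt_eq (poly_lt_cst _ 1)) => y; rewrite big_nil.
by apply: (poly_lt_eq (poly_ltM (ph i) IH)) => y; rewrite big_cons.
Qed.

(** The derivatives at (1, ..., 1) of a Laurent polynomial are sums of its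
    coefficients weighted by polynomials in the exponents; so, up to the order
    of the characteristic, this says that the Laurent polynomial with
    coefficient [c v] at the exponent [x v] vanishes to order [o] there. *)
Definition kills {I : finType} (x : I -> 'rV[F]_n) (c : I -> F) (o : nat) :=
  forall f, poly_lt o f -> \sum_v c v * f (x v) = 0.

(** Expand [f (y + x v)] into monomials in [x v] times monomials in [y]: those
    of degree less than [o] in [x v] are annihilated by [c], and the others
    have lost at least [o] of their degree in [y]. *)
Lemma poly_lt_conv {I : finType} (x : I -> 'rV[F]_n) (c : I -> F) o D f :
  kills x c o -> poly_lt D f ->
  poly_lt (D - o) (fun y => \sum_v c v * f (y + x v)).
Proof.
move=> cK; elim=> [|b s h sD _ IH].
  by apply: (poly_lt_eq (poly_lt0 _)) => y; rewrite big1// => v _; rewrite mulr0.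
(* Induction on [s] moves its factors one by one either in front of the sum or
   into [t]. *)
suff H : forall (s t : seq 'I_n) E, (size s + size t < E + o)%N ->
    poly_lt E (fun y => \sum_v c v * (mono t (x v) * mono s (y + x v))).
  have sE : (size s + size (@nil 'I_n) < D - o + o)%N.
    by rewrite addn0; lia.
  have p1 := poly_ltZ b (H s [::] _ sE).
  apply: (poly_lt_eq (poly_ltD p1 IH)) => y.
  rewrite mulr_sumr -big_split/=; apply: eq_bigr => v _.
  by rewrite /mono big_nil mul1r mulrDr mulrCA.
elim=> [|i s' IHs] t E.
  move=> tE; case: E tE => [|E] tE.
    apply: (poly_lt_eq (poly_lt0 _)) => y.
    rewrite add0n in tE; rewrite -[LHS](cK _ (poly_lt_mono 1 tE)); apply: eq_bigr => v _.
    by rewrite /mono big_nil mulr1 mul1r.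
  apply: (poly_lt_eq (poly_lt_cst E (\sum_v c v * mono t (x v)))) => y.
  by apply: eq_bigr => v _; rewrite /mono big_nil mulr1.
rewrite /= addSn => stE.
have p2 : poly_lt E (fun y => \sum_v c v * (mono (i :: t) (x v) * mono s' (y + x v))).
  by apply: IHs; rewrite /= addnS.
have p1 : poly_lt E (fun y => y 0 i * \sum_v c v * (mono t (x v) * mono s' (y + x v))).
  case: E stE {p2} => [|E] stE; last by apply: poly_lt_coordM; exact: IHs.
  have p0 : poly_lt 0 (fun y => \sum_v c v * (mono t (x v) * mono s' (y + x v))).
    by apply: IHs; exact: ltnW.
  by apply: (poly_lt_eq (poly_lt0 0)) => y; have /= -> := poly_lt0E p0 y; rewrite mulr0.
apply: (poly_lt_eq (poly_ltD p1 p2)) => y.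
rewrite mulr_sumr -big_split/=; apply: eq_bigr => v _.
rewrite /mono !big_cons mxE; ring.
Qed.

End poly_lt_theory.

(** * Dual functionals and the upper bound on depths *)

Section duality.
Context {F : fieldType} {n : nat} {I : finType}.
Variables (x : I -> 'rV[F]_n) (lam : I -> int).

(** The depth of [v] is the least degree of a polynomial function that is
    nonzero at [x v] and vanishes at all the points preceding [v] in the order
    given by [lam]. It is the number [o] such that [separates v o.+1] holds
    but [separates v o] does not. *)
Definition separates (v : I) (D : nat) := exists f : 'rV[F]_n -> F,
  [/\ poly_lt D f, f (x v) != 0 & forall w, lam w < lam v -> f (x w) = 0].

(** If [v] has depth at least [o], the indicator of [v] on the set of [v] and
    its predecessors is not a combination of monomials of degree less than
    [o]; a column of the cokernel of the matrix of values of these monomials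
    is then a functional that kills them all but is nonzero at [v]. *)
Lemma separates_dual v o : ~ separates v o -> exists c : I -> F,
  [/\ c v = 1, forall w, c w != 0 -> lam w <= lam v & kills x c o].
Proof.
move=> nsep.
pose J : finType := {k : 'I_o & k.-tuple 'I_n}.
pose e (j : 'I_#|J|) : seq 'I_n := tagged (enum_val j).
have size_e j : (size (e j) < o)%N by rewrite /e size_tuple.
pose M : 'M[F]_(#|J|, #|I|) := \matrix_(j, w)
  ((lam (enum_val w) <= lam v)%R%:R * mono (e j) (x (enum_val w))).
pose d : 'rV[F]_#|I| := delta_mx 0 (enum_rank v).
have dM : ~~ (d <= M)%MS.
  apply/negP => /submxP[b bM]; apply: nsep.
  exists (fun y => \sum_j b 0 j * mono (e j) y).
  have bE w : (lam w <= lam v)%R%:R * (\sum_j b 0 j * mono (e j) (x w)) = (w == v)%:R.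
    have /matrixP/(_ 0 (enum_rank w)) := bM.
    rewrite !mxE eqxx/= (inj_eq enum_rank_inj) => ->.
    by rewrite mulr_sumr; apply: eq_bigr => j _; rewrite mxE enum_rankK mulrCA.
  split.
  - by apply: poly_lt_sum => j _; exact: poly_lt_mono.
  - by have := bE v; rewrite lexx mul1r eqxx => ->; rewrite oner_neq0.
  - move=> w wv; have := bE w; rewrite (ltW wv) mul1r => ->.
    by case: eqP wv => // ->; rewrite ltxx.
have [k dk] : exists k, cokermx M (enum_rank v) k != 0.
  move: dM; rewrite submxE -rowE => /eqP dM; apply: contrapT => /forallNP H.
  apply: dM; apply/rowP => k; have /negP := H k; rewrite negbK => /eqP.
  by rewrite !mxE.
set u := cokermx M _ _ in dk.
exists (fun w => (lam w <= lam v)%R%:R * (cokermx M (enum_rank w) k / u)).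
split.
- by rewrite lexx mul1r divff.
- by move=> w; case: (lam w <= lam v); rewrite ?mul0r ?eqxx.
move=> f; elim=> [|b s h so _ IH]; first by rewrite big1// => w _; rewrite mulr0.
under eq_bigr do rewrite mulrDr.
rewrite big_split/= IH addr0.
pose j : 'I_#|J| := enum_rank (Tagged (fun k : 'I_o => k.-tuple 'I_n)
  (in_tuple s : (Ordinal so).-tuple 'I_n)).
have ej : e j = s by rewrite /e /j enum_rankK.
have /matrixP/(_ j k) := mulmx_coker M; rewrite !mxE => Mk.
rewrite -[RHS](mulr0 (b / u)) -[in RHS]Mk mulr_sumr.
rewrite (reindex _ (onW_bij _ (@enum_val_bij I))); apply: eq_bigr => w _.
by rewrite [M j w]mxE ej enum_valK; ring.
Qed.

End duality.

Section product_argument.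
Context {F : finFieldType} {n : nat} {I : finType}.
Variables (x : I -> 'rV[F]_n) (lam : I -> int).

(** In the field with [q] elements [t ^+ (q - 1)] is 1 unless [t] is 0, so
    this is the indicator function of [a]. *)
Definition point_indicator (a y : 'rV[F]_n) : F :=
  \prod_(i <- enum 'I_n) (1 - (y 0 i - a 0 i) ^+ #|F|.-1).

Lemma poly_lt_point_indicator a : poly_lt (n * #|F|.-1).+1 (point_indicator a).
Proof.
rewrite -[n in (n * _)%N](size_enum_ord n); apply: poly_lt_prod => i.
have p0 : poly_lt 2 (fun y : 'rV[F]_n => y 0 i - a 0 i).
  apply: (poly_lt_eq (poly_ltD (poly_lt_coordM i (poly_lt_cst 0 1)) (poly_lt_cst 1 (- a 0 i)))).
  by move=> y; rewrite mulr1.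
have := poly_ltZ (-1) (poly_ltX #|F|.-1 p0); rewrite muln1 => p1.
apply: (poly_lt_eq (poly_ltD (poly_lt_cst _ 1) p1)) => y.
by rewrite mulN1r.
Qed.

Lemma point_indicatorE a y : point_indicator a y = (y == a)%:R.
Proof.
have F1 : (1 < #|F|)%N := finRing_gt1 F.
have [->|ya] := eqVneq.
  rewrite /point_indicator big1// => i _; rewrite subrr expr0n.
  by case: eqP => [|_]; [lia|rewrite subr0].
have [i yai] : exists i, y 0 i != a 0 i.
  apply: contrapT => /forallNP H; move/eqP: ya; apply; apply/rowP => i.
  by have /negP := H i; rewrite negbK => /eqP.
rewrite /point_indicator (bigD1_seq i) ?mem_enum ?enum_uniq//=.
rewrite (_ : _ ^+ _ = 1) ?subrr ?mul0r//.
apply: (mulIf (x := y 0 i - a 0 i)); first by rewrite subr_eq0.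
by rewrite -exprSr prednK ?mul1r ?expf_card// (ltn_trans _ F1).
Qed.

Lemma separates_exists v : injective x -> separates x lam v (n * #|F|.-1).+1.
Proof.
move=> xI; exists (point_indicator (x v)); split.
- exact: poly_lt_point_indicator.
- by rewrite point_indicatorE eqxx oner_neq0.
- move=> w wv; rewrite point_indicatorE; case: eqP => // /xI E.
  by rewrite E ltxx in wv.
Qed.

Variable (c : I -> I -> F).

(** Expanded, this is the pairing of the translate [f (y + _)] with the
    product over [l] of the Laurent polynomials with coefficients [c v]: the
    sum over all tuples [m] of the product of the coefficients times [f] at
    [y] plus the sum of the points of [m]. *)
Fixpoint convol (l : seq I) (f : 'rV[F]_n -> F) (y : 'rV[F]_n) : F :=
  if l is v :: l' then \sum_w c v w * convol l' f (y + x w) else f y.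

Lemma poly_lt_convol (o : I -> nat) l D f : (forall v, kills x (c v) (o v)) ->
  poly_lt D f -> poly_lt (D - \sum_(v <- l) o v) (convol l f).
Proof.
move=> cK pf; elim: l => [|v l IH]; first by rewrite big_nil subn0.
by rewrite big_cons addnC subnDA; exact: poly_lt_conv.
Qed.

Hypothesis c_supp : forall v w, c v w != 0 -> lam w <= lam v.

Lemma convol_eq0 l f y :
  (forall m, all2 (fun w v => lam w <= lam v) m l -> f (y + \sum_(w <- m) x w) = 0) ->
  convol l f y = 0.
Proof.
elim: l y => [|v l IH] y fm /=.
  by have := fm [::] isT; rewrite big_nil addr0.
apply: big1 => w _; have [->|cvw] := eqVneq (c v w) 0; first by rewrite mul0r.
rewrite IH ?mulr0// => m ml; rewrite -addrA.
have := fm (w :: m); rewrite big_cons /= (c_supp cvw) /=; exact.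
Qed.

(** [c v] is supported on the indices not above [v], so the only term that
    contributes is the product of the leading coefficients. *)
Lemma convol_eq1 l f y : (forall v, c v v = 1) ->
  (forall m, all2 (fun w v => lam w <= lam v) m l ->
    f (y + \sum_(w <- m) x w) = (m == l)%:R) ->
  convol l f y = 1.
Proof.
move=> c1; elim: l y => [|v l IH] y fm /=.
  by have := fm [::] isT; rewrite big_nil addr0 eqxx.
rewrite (bigD1 v)//= c1 mul1r IH ?big1 ?addr0//.
- move=> w wv; have [->|cvw] := eqVneq (c v w) 0; first by rewrite mul0r.
  rewrite convol_eq0 ?mulr0// => m ml; rewrite -addrA.
  have := fm (w :: m); rewrite big_cons /= (c_supp cvw) /= => ->//.
  by rewrite eqseq_cons (negbTE wv).
- move=> m ml; rewrite -addrA.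
  have := fm (v :: m); rewrite big_cons /= lexx /= => ->//.
  by rewrite eqseq_cons eqxx.
Qed.

End product_argument.

Lemma all2_sum_eq {I : eqType} (lam : I -> int) (m l : seq I) : injective lam ->
  all2 (fun w v => lam w <= lam v) m l ->
  \sum_(w <- m) lam w = \sum_(v <- l) lam v -> m = l.
Proof.
move=> lamI; elim: m l => [|w m IH] [|v l]//= /andP[wv ml]; rewrite !big_cons => E.
have ml' : \sum_(w <- m) lam w <= \sum_(v <- l) lam v.
  elim: m l ml {IH E} => [|w' m IH] [|v' l]//=; rewrite ?big_nil// => /andP[? ?].
  by rewrite !big_cons lerD// IH.
have Ewv : lam w = lam v.
  by apply/eqP; rewrite eq_le wv -(lerD2r (\sum_(v <- l) lam v)) -E lerD2l ml'.
by rewrite (lamI _ _ Ewv) (IH l)//; apply: (addrI (lam v)); rewrite -E Ewv.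
Qed.

(** The indicator of the point [\sum_(v <- l) x v] is a polynomial of degree
    [n (q - 1)] over the field with [q] elements. Convolving it with the dual
    functional of [v] lowers the degree by the depth of [v]; if the depths
    added up to more than [n (q - 1)] the result would be zero. But its value
    at the origin is a weighted count of the tuples of points with the same
    sum as [l]; when equality of these sums forces equality of the sums of
    [lam], only the tuple [l] itself has a nonzero weight, which is 1. *)
Lemma sum_depth_le {F : finFieldType} {n : nat} {I : finType}
    (x : I -> 'rV[F]_n) (lam : I -> int) (o : I -> nat) (l : seq I) :
  injective lam ->
  (forall v, ~ separates x lam v (o v)) ->
  (forall m, size m = size l -> \sum_(w <- m) x w = \sum_(v <- l) x v ->
    \sum_(w <- m) lam w = \sum_(v <- l) lam v) ->
  (\sum_(v <- l) o v <= n * #|F|.-1)%N.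
Proof.
move=> lamI nsep rigid.
have /choice[c cP] : forall v, exists c : I -> F,
    [/\ c v = 1, forall w, c w != 0 -> lam w <= lam v & kills x c (o v)].
  by move=> v; exact: separates_dual.
have c1 v : c v v = 1 by case: (cP v).
have csupp v w : c v w != 0 -> lam w <= lam v by case: (cP v) => _ + _; exact.
have cK v : kills x (c v) (o v) by case: (cP v).
rewrite leqNgt; apply/negP => lt_o.
pose f := point_indicator (\sum_(v <- l) x v).
have := poly_lt_convol l cK (poly_lt_point_indicator (\sum_(v <- l) x v)).
rewrite (eqP lt_o) => /poly_lt0E/(_ 0).
rewrite (convol_eq1 csupp c1) => [/eqP|m ml]; first by rewrite oner_eq0.
rewrite add0r point_indicatorE; congr (_%:R); congr nat_of_bool.
apply/eqP/eqP => [E|->//]; apply: (all2_sum_eq lamI ml); apply: rigid E.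
by move: ml; rewrite all2E => /andP[/eqP].
Qed.

(** * Monomials with one bounded exponent *)

Definition reduced_exponent n d L (i0 : 'I_n) : {pred n.-tuple 'I_d.+1} :=
  [pred t : n.-tuple 'I_d.+1 | (\sum_(i <- t) i <= d)%N && (tnth t i0 <= L)%N].

Section reduced_monomials.
Context {F : fieldType} {n : nat} {I : Type}.
Variables (z : 'I_n -> I -> F) (i0 : 'I_n) (L : nat).

Inductive reduced_span (d : nat) : (I -> F) -> Prop :=
| reduced_span0 : reduced_span d (fun=> 0)
| reduced_spanD c (al : 'I_n -> nat) g : (\sum_i al i <= d)%N -> (al i0 <= L)%N ->
    reduced_span d g ->
    reduced_span d (fun v => c * \prod_i z i v ^+ al i + g v).

Lemma reduced_span_eq d g h : reduced_span d g -> g =1 h -> reduced_span d h.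
Proof. by move=> pg /funext<-. Qed.

Lemma reduced_span_add d g h : reduced_span d g -> reduced_span d h ->
  reduced_span d (fun v => g v + h v).
Proof.
move=> pg ph; elim: pg => [|c al k ad aL _ IH].
  by apply: (reduced_span_eq ph) => y; rewrite add0r.
by apply: (reduced_span_eq (reduced_spanD c ad aL IH)) => y; rewrite addrA.
Qed.

Lemma reduced_spanZ d c g : reduced_span d g -> reduced_span d (fun v => c * g v).
Proof.
elim=> [|b al h ad aL _ IH].
  by apply: (reduced_span_eq (reduced_span0 d)) => y; rewrite mulr0.
by apply: (reduced_span_eq (reduced_spanD (c * b) ad aL IH)) => y; rewrite mulrDr mulrA.
Qed.

Lemma reduced_span_mono d al : (\sum_i al i <= d)%N -> (al i0 <= L)%N ->
  reduced_span d (fun v => \prod_i z i v ^+ al i).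
Proof.
move=> ad aL; apply: (reduced_span_eq (reduced_spanD 1 ad aL (reduced_span0 d))) => y.
by rewrite addr0 mul1r.
Qed.

Lemma reduced_spanW d e g : (d <= e)%N -> reduced_span d g -> reduced_span e g.
Proof.
move=> de; elim=> [|c al h ad aL _ IH]; first exact: reduced_span0.
by apply: reduced_spanD => //; exact: leq_trans de.
Qed.

Lemma reduced_span_sum d (J : Type) (r : seq J) (P : pred J) (h : J -> I -> F) :
  (forall j, P j -> reduced_span d (h j)) ->
  reduced_span d (fun v => \sum_(j <- r | P j) h j v).
Proof.
move=> ph; elim: r => [|j r IH].
  by apply: (reduced_span_eq (reduced_span0 d)) => y; rewrite big_nil.
have [Pj|Pj] := boolP (P j).
  by apply: (reduced_span_eq (reduced_span_add (ph j Pj) IH)) => y; rewrite big_cons Pj.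
by apply: (reduced_span_eq IH) => y; rewrite big_cons (negbTE Pj).
Qed.

Variable taus : seq F.
Hypothesis size_taus : (size taus <= L.+1)%N.
Hypothesis z_taus : forall v, z i0 v \in taus.

(** As [z i0] takes at most [L + 1] values, its power [L + 1] is a combination
    of lower powers; this does not raise the total degree. *)
Lemma reduced_span_coordM d g j : reduced_span d g ->
  reduced_span d.+1 (fun v => z j v * g v).
Proof.
elim=> [|c al h ad aL _ IH].
  by apply: (reduced_span_eq (reduced_span0 d.+1)) => y; rewrite mulr0.
suff p1 : reduced_span d.+1 (fun v => z j v * \prod_i z i v ^+ al i).
  apply: (reduced_span_eq (reduced_span_add (reduced_spanZ c p1) IH)) => v.
  by rewrite mulrDr mulrCA.
pose upd k i := if i == j then k else al i.
have updE k v : \prod_i z i v ^+ upd k i = z j v ^+ k * \prod_(i | i != j) z i v ^+ al i.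
  rewrite (bigD1 j)//= /upd eqxx; congr (_ * _).
  by apply: eq_bigr => i /negbTE ->.
have updS k : (\sum_i upd k i = k + \sum_(i | i != j) al i)%N.
  rewrite (bigD1 j)//= /upd eqxx; congr (_ + _)%N.
  by apply: eq_bigr => i /negbTE ->.
rewrite (bigD1 j)//= in ad.
have [/andP[/eqP ji0 aL1]|jL] := boolP ((j == i0) && (al i0 == L)); last first.
  have p1 : reduced_span d.+1 (fun v => \prod_i z i v ^+ upd (al j).+1 i).
    apply: reduced_span_mono; first by rewrite updS addSn ltnS.
    rewrite /upd; case: eqP => // ij; rewrite -ij in jL *.
    by rewrite ltn_neqAle aL andbT; rewrite eqxx in jL.
  apply: (reduced_span_eq p1) => v.
  by rewrite updE [in RHS](bigD1 j)//= exprS mulrA.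
subst j.
pose q := \prod_(t <- taus) ('X - t%:P) * 'X^(L.+1 - size taus).
have sq : size q = L.+2.
  rewrite size_mulXn; last exact/monic_neq0/monic_prod_XsubC.
  by rewrite size_prod_XsubC addnS subnK.
have zq v : z i0 v ^+ L.+1 = - \sum_(k < L.+1) q`_k * z i0 v ^+ k.
  have : root q (z i0 v) by rewrite rootM root_prod_XsubC z_taus.
  rewrite rootE horner_coef sq big_ord_recr/=.
  have -> : q`_L.+1 = 1.
    have /monicP : q \is monic by rewrite rpredM ?monic_prod_XsubC ?monicXn.
    by rewrite /lead_coef sq.
  by rewrite mul1r addrC addr_eq0 => /eqP.
have p1 (k : 'I_L.+1) : reduced_span d.+1 (fun v => - q`_k * \prod_i z i v ^+ upd k i).
  apply: reduced_spanZ; apply: reduced_span_mono.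
    rewrite updS; apply: leq_trans (leqW ad); rewrite (eqP aL1) leq_add2r.
    by rewrite -ltnS.
  by rewrite /upd eqxx -ltnS.
apply: (reduced_span_eq (reduced_span_sum (index_enum _) (fun k _ => p1 k))) => v.
rewrite (bigD1 i0)//= mulrA -exprS (eqP aL1) zq mulNr mulr_suml -sumrN.
by apply: eq_bigr => k _; rewrite updE mulNr mulrA.
Qed.

(** Collecting equal exponents turns the inductive description into a sum over
    a finite type whose cardinal bounds the dimension of the span. *)
Lemma reduced_span_tuple d g : reduced_span d g ->
  exists b : n.-tuple 'I_d.+1 -> F, forall v, g v =
    \sum_(t | reduced_exponent L i0 t)
      b t * \prod_i z i v ^+ tnth t i.
Proof.
elim=> [|c al h ad aL _ [b bE]].
  by exists (fun=> 0) => v; rewrite big1// => t _; rewrite mul0r.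
pose u := [tuple inord (al i) : 'I_d.+1 | i < n].
have uE i : tnth u i = al i :> nat.
  by rewrite tnth_mktuple inordK// ltnS (leq_trans _ ad)// (bigD1 i)//= leq_addr.
exists (fun t => (if t == u then c else 0) + b t) => v /=.
under [RHS]eq_bigr do rewrite mulrDl.
rewrite big_split/= -bE (bigD1 u)/=; last first.
  rewrite /reduced_exponent inE uE aL andbT big_tuple (leq_trans _ ad)//.
  by apply: leq_sum => i _; rewrite uE.
rewrite eqxx [X in _ = _ + X + _]big1 ?addr0; last by move=> t /andP[_ /negbTE ->]; rewrite mul0r.
by congr (_ * _ + _); apply: eq_bigr => i _; rewrite uE.
Qed.

End reduced_monomials.

(** The functions [g v] form a triangular system for the order given by [lam],
    so they are linearly independent: evaluate a relation at the first index
    with a nonzero coefficient. *)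
Lemma card_triangular_le {F : fieldType} {I J : finType} (lam : I -> int)
    (S : {pred I}) (B : {pred J}) (g : I -> I -> F) (e : J -> I -> F) :
  injective lam ->
  (forall v, v \in S -> g v v != 0) ->
  (forall v w, v \in S -> lam w < lam v -> g v w = 0) ->
  (forall v, v \in S -> exists b : J -> F, forall w, g v w = \sum_(j in B) b j * e j w) ->
  (#|S| <= #|B|)%N.
Proof.
move=> lamI gvv gvw gspan.
have /choice[b bE] : forall v, exists b : J -> F, v \in S ->
    forall w, g v w = \sum_(j in B) b j * e j w.
  by move=> v; have [/gspan[b bE]|] := boolP (v \in S); [exists b|exists (fun=> 0)].
pose Bm : 'M[F]_(#|S|, #|B|) := \matrix_(v, j) b (enum_val v) (enum_val j).
pose Em : 'M[F]_(#|B|, #|S|) := \matrix_(j, w) e (enum_val j) (enum_val w).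
have GE v w : (Bm *m Em) v w = g (enum_val v) (enum_val w).
  rewrite bE ?enum_valP// big_enum_val mxE; apply: eq_bigr => j _.
  by rewrite !mxE.
suff : row_free (Bm *m Em).
  rewrite /row_free => /eqP <-; apply: leq_trans (mulmx_max_rank _ _) _.
  exact: leqnn.
apply: inj_row_free => u uG; apply/rowP => v0; rewrite [RHS]mxE.
apply/eqP/negP => /negP uv0.
pose v1 := [arg min_(v < v0 | u 0 v != 0) lam (enum_val v)]%O.
have [uv1 v1min] : u 0 v1 != 0 /\ forall v, u 0 v != 0 -> lam (enum_val v1) <= lam (enum_val v).
  by rewrite /v1; case: arg_minP => // v uv vmin; split.
have /rowP/(_ v1) := uG; rewrite !mxE (bigD1 v1)//= big1 ?addr0 => [/eqP|v vv1].
  by rewrite mulf_eq0 (negbTE uv1) GE (negbTE (gvv _ (enum_valP v1))).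
have [->|uv] := eqVneq (u 0 v) 0; first by rewrite mul0r.
rewrite GE gvw ?mulr0 ?enum_valP// lt_neqAle v1min// andbT.
by rewrite (inj_eq lamI) (inj_eq enum_val_inj) eq_sym.
Qed.

(** Adding [L + 1] to the exponent [i0] embeds the exponents of degree at
    most [d - L - 1] among those of degree at most [d] violating the bound
    on [i0]. *)
Lemma card_reduced_exponents n d L (i0 : 'I_n) :
  (#|reduced_exponent (d := d) L i0|
     + (if L < d then 'C(n + (d - L.+1), n) else 0) <= 'C(n + d, n))%N.
Proof.
have cardT k : #|[pred t : n.-tuple 'I_k.+1 | (\sum_(i <- t) i <= k)%N]| = 'C(n + k, n).
  by rewrite -card_partial_ord_partitions; apply: eq_card => t; rewrite !inE.
rewrite -(cardT d); set T := [pred t | _]; set A := reduced_exponent _ _.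
have AT : A \subset T by apply/fintype.subsetP => t; rewrite !inE => /andP[].
case: ifP => Ld; last by rewrite addn0 subset_leq_card.
rewrite -(cardID A T).
have -> : #|predI T A| = #|A|.
  by apply: eq_card => t; rewrite inE andb_idl// => /(fintype.subsetP AT).
rewrite leq_add2l -cardT.
set e := (d - L.+1)%N.
pose sh (t : n.-tuple 'I_e.+1) : n.-tuple 'I_d.+1 :=
  [tuple inord (tnth t i + (i == i0) * L.+1)%N | i < n].
have shE t i : tnth (sh t) i = (tnth t i + (i == i0) * L.+1)%N :> nat.
  rewrite tnth_mktuple inordK//; have := ltn_ord (tnth t i); rewrite /e.
  by case: eqP => _; lia.
have sh_inj : injective sh.
  move=> t t' E; apply: eq_from_tnth => i; apply: val_inj; apply/eqP => /=.
  by rewrite -(eqn_add2r ((i == i0) * L.+1)) -!shE E.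
rewrite -(fintype.card_image sh_inj).
apply/subset_leq_card/fintype.subsetP => _ /fintype.imageP[t + ->]; rewrite !inE => te.
rewrite big_tuple in te; rewrite shE eqxx mul1n negb_and -!ltnNge leq_addl orbT andTb.
rewrite big_tuple.
under eq_bigr do rewrite shE.
rewrite big_split/= [X in (_ + X)%N](bigD1 i0)//= eqxx mul1n.
rewrite [X in (_ + (_ + X))%N]big1 => [|i /negbTE->//].
by rewrite (leq_trans (leq_add te (leqnn _)))// /e; lia.
Qed.

(** * The lower bound on depths *)

Section depth_lower_bound.
Context {F : fieldType} {n : nat} {I : finType}.
Variables (x : I -> 'rV[F]_n) (lam : I -> int) (o : I -> nat).
Variables (u : 'rV[F]_n) (i0 : 'I_n) (taus : seq F) (L : nat).
Hypothesis u_i0 : u 0 i0 != 0.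
Hypothesis size_taus : (size taus <= L.+1)%N.
Hypothesis u_taus : forall v, \sum_i u 0 i * x v 0 i \in taus.

(** The linear form [u], which takes few values on the points, replaces the
    coordinate [i0]; this is an invertible change of variables since [u 0 i0
    != 0]. *)
Definition adapted_coord (i : 'I_n) (v : I) : F :=
  if i == i0 then \sum_j u 0 j * x v 0 j else x v 0 i.

Lemma poly_lt_reduced_span d f : poly_lt d.+1 f ->
  reduced_span adapted_coord i0 L d (f \o x).
Proof.
have z_taus v : adapted_coord i0 v \in taus by rewrite /adapted_coord eqxx.
have coordM e g i : reduced_span adapted_coord i0 L e g ->
    reduced_span adapted_coord i0 L e.+1 (fun v => x v 0 i * g v).
  move=> pg; have zM j := reduced_span_coordM size_taus z_taus j pg.
  have [->|ii0] := eqVneq i i0; last first.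
    by apply: (reduced_span_eq (zM i)) => v; rewrite /adapted_coord (negbTE ii0).
  have p1 (j : 'I_n) : j != i0 -> reduced_span adapted_coord i0 L e.+1
      (fun v => - u 0 j * (adapted_coord j v * g v)).
    by move=> _; exact: reduced_spanZ.
  have p2 := reduced_spanZ (u 0 i0)^-1
    (reduced_span_add (zM i0) (reduced_span_sum (index_enum _) p1)).
  apply: (reduced_span_eq p2) => v.
  rewrite /adapted_coord eqxx (bigD1 i0)//= mulrDl -addrA mulr_suml -big_split/= big1.
    by rewrite addr0 -mulrA mulKf.
  by move=> j /negbTE ->; ring.
elim=> [|c s h sd _ IH]; first exact: reduced_span0.
apply: reduced_span_add IH; apply: reduced_spanZ.
rewrite ltnS in sd; apply: (reduced_spanW sd) => {c h sd}.
elim: s => [|i s IHs].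
  have p1 : reduced_span adapted_coord i0 L 0
      (fun v => \prod_i adapted_coord i v ^+ (fun=> 0%N) i).
    by apply: reduced_span_mono => //; rewrite big1.
  by apply: (reduced_span_eq p1) => v; rewrite /= /mono big_nil big1.
by apply: (reduced_span_eq (coordM _ _ i IHs)) => v; rewrite /= /mono big_cons.
Qed.

Hypothesis lamI : injective lam.
Hypothesis o_sep : forall v, separates x lam v (o v).+1.

(** Choose for each point of depth at most [d] a polynomial witnessing its
    depth: these polynomials are triangular, and they lie in the span of the
    reduced monomials of degree at most [d]. *)
Lemma card_depth_le d :
  (#|[pred v | (o v <= d)%N]| <= #|reduced_exponent (d := d) L i0|)%N.
Proof.
have /choice[f fP] : forall v, exists f : 'rV[F]_n -> F, [/\ poly_lt (o v).+1 f,
    f (x v) != 0 & forall w, lam w < lam v -> f (x w) = 0] by [].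
apply: (card_triangular_le (S := [pred v | (o v <= d)%N])
  (B := reduced_exponent L i0) (g := fun v => f v \o x) (lam := lam) (e := fun (t : n.-tuple 'I_d.+1) v => \prod_i adapted_coord i v ^+ tnth t i)) => //.
- by move=> v _; have [] := fP v.
- by move=> v w _ wv; have [_ _] := fP v; apply.
move=> v; rewrite inE => ovd; have [pf _ _] := fP v.
have := poly_lt_reduced_span (poly_ltW (_ : ((o v).+1 <= d.+1)%N) pf).
by move=> /(_ ovd)/reduced_span_tuple.
Qed.

Lemma sum_minn_succ d : (\sum_v minn (o v) d.+1 =
  \sum_v minn (o v) d + (#|I| - #|[pred v | (o v <= d)%N]|))%N.
Proof.
rewrite -(cardC [pred v | (o v <= d)%N]) addKn -sum1_card [X in (_ + X)%N]big_mkcond -big_split/=.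
apply: eq_bigr => v _; rewrite !inE -ltnNge.
by case: ltnP => ovd; lia.
Qed.

(** The sum of the depths is the sum over [d] of the number of points of depth
    greater than [d], which [card_depth_le] bounds below; the binomial
    coefficients add up by the hockey-stick identity, applied here one step at
    a time through Pascal's rule. *)
Lemma sum_depth_ge E :
  ((L.+1 + E) * #|I| + 'C(n + E, n.+1)
     <= \sum_v o v + 'C(n + (L.+1 + E), n.+1))%N.
Proof.
suff H : ((L.+1 + E) * #|I| + 'C(n + E, n.+1)
     <= \sum_v minn (o v) (L.+1 + E) + 'C(n + (L.+1 + E), n.+1))%N.
  apply: leq_trans H _; rewrite leq_add2r; apply: leq_sum => v _; exact: geq_minl.
have step d : (#|I| <= (#|I| - #|[pred v | (o v <= d)%N]|) + #|reduced_exponent (d := d) L i0|)%N.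
  by rewrite addnC -leq_subLR leq_sub2l// card_depth_le.
have cardE d := card_reduced_exponents d L i0.
elim: E => [|E IH].
  rewrite !addn0 bin_small// addn0.
  have : (L.+1 <= L.+1)%N by [].
  elim: {1 3 4 5}L.+1 => [|d IH] dL.
    by rewrite mul0n.
  rewrite addnS binS sum_minn_succ mulSn.
  have := IH (ltnW dL); have := step d; have := cardE d.
  by case: (ltnP L d) => [|_]; lia.
rewrite !(addnS _ E); have [Ld dE] : (L < L.+1 + E)%N /\ (L.+1 + E - L.+1 = E)%N by lia.
move: (L.+1 + E)%N => d in Ld dE IH *.
rewrite !addnS (binS (n + E)) (binS (n + d)) sum_minn_succ mulSn.
by have := step d; have := cardE d; rewrite Ld dE; lia.
Qed.

End depth_lower_bound.

(** * Finite sets of lattice points *)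

(** The difference of two distinct points, read as a polynomial, is nonzero;
    so is the product over all pairs, and any [b] outside its roots works. *)
Lemma exists_linear_injection n (I : finType) (m : I -> 'rV[int]_n) :
  injective m -> exists b : int, injective (fun v => (rVpoly (m v)).[b]).
Proof.
move=> mI.
pose Q := \prod_(vw : I * I | vw.1 != vw.2) rVpoly (m vw.1 - m vw.2).
have Q0 : Q != 0.
  apply/prodf_neq0 => -[v w] /=; apply: contra_neq => /(congr1 (@poly_rV int n)).
  by rewrite rVpolyK linear0 => /subr0_eq/mI.
have [b bQ] : exists b, ~~ root Q b.
  apply: contrapT => /forallNP H.
  have := max_poly_roots Q0 (rs := [seq Posz k | k <- iota 0 (size Q)]).
  rewrite size_map size_iota ltnn map_inj_uniq ?iota_uniq; last by move=> ? ? [].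
  move=> H'; suff : false by []; apply: H' => //; apply/allP => k _.
  by have /negP := H k; rewrite negbK.
exists b => v w E; apply/eqP/negP => /negP vw; move/negP: bQ; apply.
rewrite /root horner_prod; apply/eqP/eqP; rewrite prodf_seq_eq0.
apply/hasP; exists (v, w); first exact: mem_index_enum.
by rewrite /= vw linearB/= hornerE hornerN E subrr.
Qed.

(** Comparison of the two bounds on depths, for the points reduced modulo [p]
    and with every point repeated [a] times in the product. *)
Lemma lattice_points_bound (p n : nat) (I : finType) (m : I -> 'rV[int]_n)
    (u : 'rV[int]_n) (i0 : 'I_n) (A : int) (L a E : nat) :
  prime p -> injective m ->
  injective (fun v => map_mx intr (m v) : 'rV['F_p]_n) ->
  (u 0 i0)%:~R != 0 :> 'F_p ->
  (forall v, A <= \sum_i u 0 i * m v 0 i <= A + L%:Z) ->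
  (forall s : seq I, size s = (a * #|I|)%N ->
    \sum_(w <- s) map_mx intr (m w) = (\sum_v map_mx intr (m v)) *+ a :> 'rV['F_p]_n ->
    \sum_(w <- s) m w = (\sum_v m v) *+ a) ->
  (a * ((L.+1 + E) * #|I| + 'C(n + E, n.+1))
     <= n * p.-1 + a * 'C(n + (L.+1 + E), n.+1))%N.
Proof.
move=> p_pr mI; set x := fun v => _ => xI ui0 uA rigid.
have [b] := exists_linear_injection mI; set lam := fun v => _ => lamI.
have /choice[dep depP] : forall v, exists o,
    ~ separates x lam v o /\ separates x lam v o.+1.
  move=> v; have ex : exists D, `[< separates x lam v D >].
    by eexists; apply/asboolP; exact: separates_exists.
  have [[|D] /asboolP sD minD] := ex_minnP ex.
    by case: sD => f [/poly_lt0E ->]; rewrite eqxx.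
  by exists D; split => // /asboolP/minD; rewrite ltnn.
pose l := flatten (nseq a (enum I)).
have size_l : size l = (a * #|I|)%N.
  by rewrite size_flatten /shape map_nseq sumn_nseq -cardE mulnC.
have sum_l (V : nmodType) (h : I -> V) : \sum_(v <- l) h v = (\sum_v h v) *+ a.
  rewrite /l; elim: {+}a => [|k IH]; first by rewrite big_nil mulr0n.
  by rewrite /= big_cat/= IH mulrS big_enum.
have le_l : (a * \sum_v dep v <= n * p.-1)%N.
  have := @sum_depth_le _ _ _ x lam dep l lamI (fun v => (depP v).1).
  rewrite card_Fp// => le_l.
  have -> : (a * \sum_v dep v = \sum_(v <- l) dep v)%N.
    by rewrite sum_l -mulr_natl natn.
  apply: le_l => s size_s; rewrite sum_l => /rigid H.
  have lamS t : \sum_(w <- t) lam w = (rVpoly (\sum_(w <- t) m w)).[b].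
    by rewrite linear_sum horner_sum.
  by rewrite !lamS H -?size_l// -sum_l.
pose taus : seq 'F_p := [seq (A + k%:Z)%:~R | k <- iota 0 L.+1].
have := @sum_depth_ge _ _ _ x lam dep (map_mx intr u) i0 taus L _ _ _ lamI (fun v => (depP v).2) E.
rewrite mxE size_map size_iota => /(_ ui0 (leqnn _)) ge_l.
suff /ge_l : forall v, \sum_i map_mx intr u 0 i * x v 0 i \in taus by nia.
move=> v; have /andP[Av vA] := uA v.
apply/mapP; exists (absz (\sum_i u 0 i * m v 0 i - A)%R); first by rewrite mem_iota; lia.
rewrite gez0_abs ?subr_ge0// addrC subrK rmorph_sum; apply: eq_bigr => i _.
by rewrite rmorphM/= !mxE.
Qed.

(** * Row vectors and grid cells *)

Section row_vector_topology.
Context {R : realType} {n : nat}.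
Implicit Types (K : set 'rV[R]_n) (x y : 'rV[R]_n).

(** The ball conditions are unfolded to coordinates here, so that the rest of
    the argument can be carried out with real inequalities. *)
Lemma interior_rVP K x :
  interior K x <-> exists2 r : R, 0 < r & forall y, (forall i, `|y 0 i - x 0 i| < r) -> K y.
Proof.
rewrite /interior; split=> [/nbhs_ballP[r /= r0 rK]|[r r0 rK]].
  exists r => // y yx; apply: rK; split => // i j.
  by rewrite /ball/= distrC ord1.
apply/nbhs_ballP; exists r => //= y [_ yx]; apply: rK => i.
by have := yx 0 i; rewrite /ball/= distrC.
Qed.

Lemma closed_rVP K x : closed K -> ~ K x ->
  exists2 r : R, 0 < r & forall y, (forall i, `|y 0 i - x 0 i| < r) -> ~ K y.
Proof.
move=> /closed_openC; rewrite openE => oK Kx.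
by have /interior_rVP := oK x Kx.
Qed.

Lemma compact_rV_bounded K : compact K ->
  exists B : nat, forall x i, K x -> `|x 0 i| <= B%:R.
Proof.
move=> /compact_bounded[M [Mreal MK]]; exists (Num.bound `|M + 1|) => x i Kx.
have xM : `|x| <= M + 1 by apply: MK => //; rewrite ltrDl.
apply: (@le_trans _ _ `|x|).
  by rewrite [leRHS]/Num.norm/= mx_normrE; apply/bigmax_geP; right; exists (0, i).
by rewrite (le_trans xM)// (le_trans (ler_norm _))// ltW// archi_boundP.
Qed.

Lemma compact_rV_closed K : compact K -> closed K.
Proof. by apply: compact_closed; exact: norm_hausdorff. Qed.

Lemma convex_rVP K x y t : convex_set K -> K x -> K y -> 0 <= t <= 1 ->
  K (t *: x + (1 - t) *: y).
Proof.
move=> cK Kx Ky /andP[t0 t1].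
have := cK x y (Itv01 t0 t1); rewrite !inE => /(_ Kx Ky).
by rewrite /conv/=.
Qed.

End row_vector_topology.

Section grid.
Context {R : realType} {n : nat}.
Implicit Types (K : set 'rV[R]_n) (h : R) (m : 'rV[int]_n) (y : 'rV[R]_n).

Definition lattice_point m : 'rV[R]_n := map_mx intr m.

(** The sides are half-open so that the cells partition the space and every
    point has exactly one index, see [cellP]. *)
Definition cell_side h m (i : 'I_n) : set (measurableTypeR R) :=
  `[(m 0 i)%:~R * h, (m 0 i + 1)%:~R * h[%classic.

Definition cell h m : set 'rV[R]_n := [set y | forall i, cell_side h m i (y 0 i)].

Definition cell_index h y : 'rV[int]_n := \row_i Num.floor (y 0 i / h).

Lemma cellP h m y : 0 < h -> cell h m y <-> m = cell_index h y.
Proof.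
move=> h0; split=> [ym|->].
  apply/rowP => i; rewrite mxE; apply/esym; apply: floor_def.
  by have := ym i; rewrite /cell_side/= in_itv/= -ler_pdivlMr// -ltr_pdivrMr.
move=> i; rewrite /cell_side/= in_itv/= mxE -ler_pdivlMr// -ltr_pdivrMr//.
by rewrite floor_le floorD1_gt.
Qed.

Lemma cell_index_dist h y i : 0 < h ->
  `|(h *: lattice_point (cell_index h y)) 0 i - y 0 i| <= h.
Proof.
move=> h0; have /(_ i) := (cellP (cell_index h y) y h0).2 erefl.
rewrite /cell_side/= in_itv/= !mxE rmorphD/= mulrDl mul1r mulrC => /andP[? ?].
by rewrite ler_norml; lra.
Qed.

Lemma measurable_cell h m : measurable (cell h m).
Proof. by apply: (measurable_box (A := cell_side h m)) => i; exact: measurable_itv. Qed.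

Lemma lebesgue_cell h m : 0 < h -> lebesgue_rV n (cell h m) = (h ^+ n)%:E.
Proof.
move=> h0; rewrite (lebesgue_rV_box (A := cell_side h m)); last by move=> i; exact: measurable_itv.
rewrite (eq_bigr (fun=> h%:E)); last first.
  move=> i _; rewrite /cell_side lebesgue_measure_itv/= lte_fin ltr_pM2r// ltr_int ltzD1 lexx.
  by rewrite -EFinB -mulrBl rmorphD/= addrC addKr mul1r.
by rewrite prodEFin prodr_const card_ord.
Qed.

(** A closed set is the intersection over [k] of the unions of the cells of
    side [1 / (k + 1)] that meet it, and there are countably many cells. *)
Lemma closed_rV_measurable K : closed K -> measurable K.
Proof.
move=> cK; pose h (k : nat) : R := k.+1%:R^-1.
have h0 k : 0 < h k by rewrite invr_gt0.
have -> : K = \bigcap_k \bigcup_(m : 'rV[int]_n)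
    (cell (h k) m `&` [set _ | exists2 z, K z & cell (h k) m z]).
  apply/seteqP; split => [y Ky k _|y Uy].
    exists (cell_index (h k) y) => //; split; first exact/cellP.
    by exists y => //; exact/cellP.
  apply: contrapT => /(closed_rVP cK)[r r0 rK].
  have [k kr] : exists k, h k < r.
    have [k _ kr] := near_infty_natSinv_lt (PosNum r0).
    by exists k; exact: (kr k (leqnn k)).
  have [m _ [ym [z Kz zm]]] := Uy k I.
  apply: (rK z) => // i.
  have := ym i; have := zm i; rewrite /cell_side/= !in_itv/= rmorphD/= mulrDl mul1r.
  by move=> /andP[? ?] /andP[? ?]; rewrite ltr_norml; lra.
apply: bigcapT_measurable => k; apply: countable_bigcupT_measurable.
  exact: countableP.
move=> m; have [H|H] := pselect (exists2 z, K z & cell (h k) m z).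
  rewrite (_ : [set _ | _] = setT) ?setIT; first exact: measurable_cell.
  by apply/seteqP; split.
rewrite (_ : [set _ | _] = set0) ?setI0; first exact: measurable0.
by apply/seteqP; split.
Qed.

Lemma interior_rV_measurable K : measurable (interior K).
Proof.
rewrite -[interior K]setCK; apply: measurableC; apply: closed_rV_measurable.
by apply: open_closedC; exact: open_interior.
Qed.

End grid.

(** * Lebesgue measure of dilated sets *)

Section scaling.
Context {R : realType}.
Local Open Scope ereal_scope.

Let dil1 (c : R) (x : measurableTypeR R) : measurableTypeR R := (c * x)%R.

Let measurable_dil1 c : measurable_fun setT (dil1 c).
Proof. exact: mulrl_measurable. Qed.

Lemma lebesgue_measure_dilation (c : R) (A : set (measurableTypeR R)) :
  (0 < c)%R -> measurable A ->
  lebesgue_measure ((fun x : measurableTypeR R => (c * x)%R : measurableTypeR R) @^-1` A)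
    = c^-1%:E * lebesgue_measure A.
Proof.
move=> c0 mA; have c1 : (0 <= c)%R := ltW c0.
pose M1 := measure_function_pushforward__canonical__measure_function_Measure
  (@lebesgue_measure R) (measurable_dil1 c).
pose M2 := measure_function_mscale__canonical__measure_function_Measure (NngNum c1) M1.
have -> : lebesgue_measure A = M2 A.
  apply: lebesgue_measure_unique mA => _ [[a b] _ <-] /=.
  rewrite /mscale/= /pushforward.
  have -> : dil1 c @^-1` `]a, b]%classic = `](a / c)%R, (b / c)%R]%classic.
    by apply/seteqP; split => x;
      rewrite /= !in_itv/= ltr_pdivrMr// ler_pdivlMr// /dil1 mulrC.
  rewrite !lebesgue_measure_itv/= !lte_fin ltr_pM2r ?invr_gt0//.
  by case: ifP => _; rewrite ?mule0// -EFinB -EFinM -mulrBl mulrC divfK ?gt_eqF.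
by rewrite /M2/= /mscale/= muleA -EFinM mulVf ?gt_eqF// mul1e.
Qed.

Context {n : nat}.

Let dil (c : R) (x : 'rV[R]_n) : 'rV[R]_n := (c *: x)%R.

Let measurable_dil c : measurable_fun setT (dil c).
Proof.
apply: measurable_fun_coord => i.
under eq_fun do rewrite /dil mxE.
exact: measurableT_comp (measurable_dil1 c) (measurable_coord i).
Qed.

(** Both sides define measures that agree on boxes, and boxes generate the
    sigma-algebra. *)
Lemma lebesgue_rV_dilation (c : R) (A : set 'rV[R]_n) : (0 < c)%R -> measurable A ->
  lebesgue_rV n ((fun x => c *: x)%R @^-1` A) = (c ^- n)%:E * lebesgue_rV n A.
Proof.
move=> c0 mA; have c1 : (0 <= c ^- n)%R by rewrite invr_ge0 exprn_ge0// ltW.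
pose M1 := measure_function_pushforward__canonical__measure_function_Measure
  (lebesgue_rV n) (measurable_dil c).
pose M2 := measure_function_mscale__canonical__measure_function_Measure
  (NngNum c1) (lebesgue_rV n).
pose G : set (set 'rV[R]_n) := [set B | exists2 S : 'I_n -> set (measurableTypeR R),
  (forall i, measurable (S i)) & B = [set x : 'rV[R]_n | forall i, S i (x 0%R i)]].
(* Bounded boxes exhausting the space give the finiteness condition of the
   uniqueness theorem. *)
pose g (k : nat) : set 'rV[R]_n := [set x | forall i, `](- k%:R)%R, k%:R[%classic (x 0%R i)].
have M12 (S : 'I_n -> set (measurableTypeR R)) : (forall i, measurable (S i)) ->
    M1 [set x : 'rV[R]_n | forall i, S i (x 0%R i)] =
    M2 [set x : 'rV[R]_n | forall i, S i (x 0%R i)].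
  move=> mS; rewrite /M1 /M2 /= /mscale/= lebesgue_rV_box//.
  pose T i : set (measurableTypeR R) := dil1 c @^-1` S i.
  have -> : pushforward (lebesgue_rV n) (dil c) [set x : 'rV[R]_n | forall i, S i (x 0%R i)]
      = lebesgue_rV n [set x : 'rV[R]_n | forall i, T i (x 0%R i)].
    congr (lebesgue_rV n _); apply/seteqP; split=> x /= Sx i.
      by have := Sx i; rewrite mxE.
    by rewrite mxE; exact: Sx.
  rewrite (lebesgue_rV_box (A := T)); last first.
    by move=> i; rewrite /T -[X in measurable X]setTI; exact: measurable_dil1.
  rewrite (eq_bigr (fun i => c^-1%:E * lebesgue_measure (S i))); last first.
    by move=> i _; exact: lebesgue_measure_dilation.
  by rewrite big_split/= prodEFin prodr_const card_ord exprVn.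
suff : M1 A = M2 A by [].
apply: (@measure_unique _ R _ G g) mA => //.
- apply/seteqP; split.
    apply: smallest_sub; first exact: smallest_sigma_algebra.
    move=> B; rewrite -bigcup_seq/= => -[i _ [C mC <-]].
    apply: sub_sigma_algebra => /=; exists (fun j => if j == i then C else setT).
      by move=> j; case: eqP.
    rewrite setTI; apply/seteqP; split=> x /= => [Cx j|/(_ i)]; last by rewrite eqxx.
    by case: eqP => // ->.
  apply: smallest_sub; first exact: sigma_algebra_measurable.
  by move=> B [S mS ->]; exact: measurable_box.
- move=> _ _ [S mS ->] [T mT ->]; exists (fun i => S i `&` T i).
    by move=> i; exact: measurableI.
  apply/seteqP; split=> x /= => [[Sx Tx] i|ST]; first by split.
  by split=> i; have [] := ST i.
- move=> k; exists (fun=> `](- k%:R)%R, k%:R[%classic) => // i.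
- rewrite -subTset => x _.
  pose B := Num.bound (\sum_i `|x 0%R i|)%R.
  exists B => // i /=; rewrite in_itv/= -ltr_norml.
  apply: le_lt_trans (archi_boundP _); last by apply: sumr_ge0.
  by rewrite (bigD1 i)//= lerDl sumr_ge0.
- by move=> _ [S mS ->]; exact: M12.
- move=> k; rewrite (M12 (fun=> `](- k%:R)%R, k%:R[%classic))//.
  rewrite /M2/= /mscale/= (lebesgue_rV_box (A := fun=> `](- k%:R)%R, k%:R[%classic))//.
  rewrite ltey_eq fin_numM// prode_fin_num// => i _.
  by rewrite lebesgue_measure_itv/=; case: ifP.
Qed.

End scaling.

(** * The boundary of a convex body is null *)

Lemma bernoulli_ge {R : realFieldType} (s : R) n : 0 <= s <= 1 ->
  1 - n%:R * s <= (1 - s) ^+ n.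
Proof.
move=> /andP[s0 s1]; elim: n => [|n IH]; first by rewrite mul0r subr0 expr0.
rewrite exprS -natr1; apply: le_trans (ler_wpM2l _ IH); last by rewrite subr_ge0.
have : 0 <= n%:R * s * s by rewrite !mulr_ge0.
nra.
Qed.

Section convex_boundary.
Context {R : realType} {n : nat}.
Implicit Types (K : set 'rV[R]_n) (x w : 'rV[R]_n).

(** A small ball around [w] is carried by the homothety of centre [x] and
    ratio [1 - t] to a ball around the point. *)
Lemma convex_interior K x w t : convex_set K -> K x -> interior K w -> 0 <= t < 1 ->
  interior K (t *: x + (1 - t) *: w).
Proof.
move=> cK Kx /interior_rVP[r r0 rK] /andP[t0 t1]; apply/interior_rVP.
have t1' : 0 < 1 - t by rewrite subr_gt0.
exists ((1 - t) * r); first exact: mulr_gt0.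
move=> y yx; pose w' := (1 - t)^-1 *: (y - t *: x).
have -> : y = t *: x + (1 - t) *: w'.
  by rewrite scalerA divff ?gt_eqF// scale1r addrC subrK.
apply: convex_rVP => //; last by rewrite t0 ltW.
apply: rK => i; rewrite -(ltr_pM2l t1').
have -> : (1 - t) * `|w' 0 i - w 0 i| = `|y 0 i - (t *: x + (1 - t) *: w) 0 i|.
  rewrite -{1}(gtr0_norm t1') -normrM; congr (`|_|).
  by rewrite !mxE mulrBr mulrA divff ?gt_eqF// mul1r; ring.
exact: yx.
Qed.

Lemma compact_rV_fin_num K : compact K -> lebesgue_rV n K \is a fin_num.
Proof.
move=> cK; have [B KB] := compact_rV_bounded cK.
pose S (i : 'I_n) : set (measurableTypeR R) := `[- B%:R, B%:R]%classic.
rewrite ge0_fin_numE//.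
apply: (@le_lt_trans _ _ (lebesgue_rV n [set x : 'rV[R]_n | forall i, S i (x 0 i)])).
  apply: le_measure; rewrite ?inE.
  - exact: (closed_rV_measurable (compact_rV_closed cK)).
  - by apply: (measurable_box (A := S)) => i; exact: measurable_itv.
  - by move=> x Kx i; rewrite /S /= in_itv/= -ler_norml; exact: KB.
rewrite (lebesgue_rV_box (A := S)) => [|i]; last exact: measurable_itv.
rewrite ltey_eq prode_fin_num// => i _.
by rewrite lebesgue_measure_itv/=; case: ifP.
Qed.

(** For [0 < t < 1] the dilated body [t K] lies in the interior, so the
    boundary has measure at most [(1 - t ^ n)] times that of [K]; let [t] tend
    to 1. *)
Lemma convex_boundary_null K : compact K -> convex_set K -> interior K 0 ->
  lebesgue_rV n (K `\` interior K) = 0%E.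
Proof.
move=> cK convK K0.
have mK : measurable K by exact: (closed_rV_measurable (compact_rV_closed cK)).
have mI := interior_rV_measurable K.
have mD : measurable (K `\` interior K) by exact: measurableD.
have sub A : measurable A -> A `<=` K -> lebesgue_rV n A \is a fin_num.
  move=> mA AK; rewrite ge0_fin_numE//; apply: (@le_lt_trans _ _ (lebesgue_rV n K)).
    by apply: le_measure; rewrite ?inE.
  by rewrite -ge0_fin_numE// compact_rV_fin_num.
have IK : interior K `<=` K := @interior_subset _ K.
have Dfin := sub _ mD (@subDsetl _ _ _).
have KE : lebesgue_rV n K = (lebesgue_rV n (interior K) + lebesgue_rV n (K `\` interior K))%E.
  rewrite -measureU//; last by rewrite setDE setIA setIAC setICr set0I.
  by rewrite setDUK.
move: (sub _ mI IK) Dfin KE; move eqw : (lebesgue_rV n (interior K)) => [w| |]//.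
move eqd : (lebesgue_rV n (K `\` interior K)) => [d| |]// _ _.
rewrite -EFinD => KE.
have d0 : 0 <= d by rewrite -lee_fin -eqd.
have w0 : 0 <= w by rewrite -lee_fin -eqw.
congr EFin; apply/eqP; rewrite eq_le d0 andbT leNgt; apply/negP => d_gt0.
have [v vE] : exists v, v = w + d by exists (w + d).
have v0 : 0 <= v by rewrite vE addr_ge0.
have shrink (t : R) : 0 < t < 1 -> t ^+ n * v <= w.
  move=> /andP[t0 t1]; rewrite -lee_fin EFinM vE -KE -eqw.
  have -> : t ^+ n = t^-1 ^- n by rewrite exprVn invrK.
  rewrite -lebesgue_rV_dilation ?invr_gt0//; apply: le_measure; rewrite ?inE//.
    rewrite -[X in measurable X]setTI.
    apply: (measurable_fun_coord (f := fun x : 'rV[R]_n => t^-1 *: x)) => // i.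
    under eq_fun do rewrite mxE.
    apply: (measurableT_comp (f := *%R t^-1) _ (measurable_coord i)).
    exact: mulrl_measurable.
  move=> y /= Ky; have -> : y = t *: (t^-1 *: y) + (1 - t) *: 0.
    by rewrite scaler0 addr0 scalerA divff ?gt_eqF// scale1r.
  by apply: convex_interior => //; rewrite t1 ltW.
have vn0 : 0 <= v * n%:R by rewrite mulr_ge0.
have den0 : 0 < 2 * (v * n%:R + d) by lra.
(* With [1 - t = s] and the estimate [1 - t ^ n <= n s], this [s] makes the
   boundary measure at most half of itself. *)
have [s [s0 s1 sE]] : exists s : R, [/\ 0 < s, s < 1 & s * (2 * (v * n%:R + d)) = d].
  exists (d / (2 * (v * n%:R + d))); split; first exact: divr_gt0.
    by rewrite ltr_pdivrMr//; lra.
  by rewrite divfK ?gt_eqF.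
have H1 : (1 - s) ^+ n * v <= w by apply: shrink; rewrite subr_gt0 s1 gtrBl s0.
have H2 : (1 - n%:R * s) * v <= w.
  by apply: le_trans H1; rewrite ler_wpM2r// bernoulli_ge// (ltW s0) ltW.
have H3 : 0 < s * d by exact: mulr_gt0.
have H4 : d <= v * n%:R * s by nra.
by move: d_gt0 sE H3 H4; clear; nra.
Qed.

End convex_boundary.

(** * Riemann sums over the lattice *)

Lemma finite_bounded_lattice n (M : nat) :
  finite_set [set m : 'rV[int]_n | forall i, `|m 0 i| <= M%:Z].
Proof.
pose g (t : {ffun 'I_n -> 'I_(M + M).+1}) : 'rV[int]_n := \row_i ((t i)%:Z - M%:Z).
apply: (@sub_finite_set _ _ (g @` setT)); last exact/finite_image/finite_finset.
move=> m /= mM; exists [ffun i => inord (absz (m 0 i + M%:Z)%R)] => //.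
apply/rowP => i; rewrite mxE ffunE; have := mM i; rewrite ler_norml => /andP[m1 m2].
by rewrite inordK; lia.
Qed.

Lemma integrable_indic_fin d (T : measurableType d) (R : realType)
    (mu : {measure set T -> \bar R}) (A : set T) :
  measurable A -> (mu A < +oo)%E -> mu.-integrable setT (fun x => (\1_A x)%:E).
Proof.
move=> mA Afin; apply/integrableP; split.
  by apply/measurable_EFinP; exact: measurable_indic.
under eq_integral do rewrite /= ger0_norm//.
by rewrite integral_indic// setIT.
Qed.

Section riemann_sums.
Context {R : realType} {n : nat}.
Implicit Types (K : set 'rV[R]_n) (f : 'rV[R]_n -> R).

Definition grid K (k : nat) : seq 'rV[int]_n :=
  finmap.enum_fset (fset_set [set m | K (k.+1%:R^-1 *: lattice_point m)]).

Lemma mem_grid K k m : compact K ->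
  (m \in grid K k) = `[< K (k.+1%:R^-1 *: lattice_point m) >].
Proof.
move=> /compact_rV_bounded[B KB].
rewrite /grid; apply: etrans (in_fset_set _ m) _; last first.
  by apply/idP/asboolP => [/set_mem|/mem_set].
apply: sub_finite_set (@finite_bounded_lattice n (B * k.+1)) => {}m /= Km i.
rewrite -(ler_int R) intr_norm -pmulrn natrM.
have := KB _ i Km; rewrite !mxE normrM ger0_norm ?invr_ge0//.
by rewrite mulrC ler_pdivrMr.
Qed.

Lemma grid_uniq K k : uniq (grid K k).
Proof. exact: finmap.fset_uniq. Qed.

(** The sum is the integral of the step function equal on each cell to the
    value of [f] at its corner if that corner is in [K], and to 0 otherwise.
    Off the boundary of [K] these functions converge to [f] restricted to [K],
    and they are dominated by a multiple of the indicator of a box. *)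
Lemma riemann_sum_cvg K f (C : R) : compact K ->
  lebesgue_rV n (K `\` interior K) = 0%E ->
  measurable_fun setT (f : _ -> measurableTypeR R) ->
  (forall y, K y -> `|f y| <= C) ->
  (forall (y : 'rV[R]_n) (e : R), 0 < e -> exists2 r : R, 0 < r &
     forall z : 'rV[R]_n, (forall i, `|z 0 i - y 0 i| < r) -> `|f z - f y| < e) ->
  k.+1%:R ^- n * (\sum_(m <- grid K k) f (k.+1%:R^-1 *: lattice_point m))
    @[k --> \oo] --> \int[lebesgue_rV n]_(y in K) f y.
Proof.
move=> cK bd0 mf fC fcont.
have mK : measurable K := closed_rV_measurable (compact_rV_closed cK).
have [B KB] := compact_rV_bounded cK.
pose h (k : nat) : R := k.+1%:R^-1.
have h0 k : 0 < h k by rewrite invr_gt0.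
have h1 k : h k <= 1 by rewrite invf_le1 ?ler1n.
pose g k y : R := \sum_(m <- grid K k) f (h k *: lattice_point m) * \1_(cell (h k) m) y.
have gE k y : g k y = let z := h k *: lattice_point (cell_index (h k) y) in
    if `[< K z >] then f z else 0.
  rewrite /g/= -(mem_grid _ _ cK); set m0 := cell_index _ _.
  have ind m : \1_(cell (h k) m) y = (m == m0)%:R :> R.
    by rewrite indicE; congr (_%:R); congr nat_of_bool; apply/idP/eqP; rewrite inE cellP.
  case: ifPn => m0g.
    rewrite (bigD1_seq m0) ?grid_uniq//= ind eqxx mulr1 big1 ?addr0// => m mm0.
    by rewrite ind (negbTE mm0) mulr0.
  rewrite big_seq big1// => m mg; rewrite ind.
  by case: eqP => [E|_]; [rewrite -E mg in m0g|rewrite mulr0].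
pose S (i : 'I_n) : set (measurableTypeR R) := `[- (B.+1)%:R, (B.+1)%:R]%classic.
pose Q := [set y : 'rV[R]_n | forall i, S i (y 0 i)].
have mQ : measurable Q by apply: (measurable_box (A := S)) => i; exact: measurable_itv.
have Qfin : (lebesgue_rV n Q < +oo)%E.
  rewrite (lebesgue_rV_box (A := S)) => [|i]; last exact: measurable_itv.
  by rewrite ltey_eq prode_fin_num// => i _; rewrite lebesgue_measure_itv/=; case: ifP.
have C0 y : K y -> 0 <= C by move=> /fC; exact: le_trans.
have gQ k y : `|g k y| <= `|C| * \1_Q y.
  rewrite gE/=; case: asboolP => [Kz|_]; last by rewrite normr0 mulr_ge0.
  rewrite indicE mem_set ?mulr1.
    by apply: le_trans (fC _ Kz) (ler_norm _).
  move=> i; rewrite /S/= in_itv/= -ler_norml.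
  have := KB _ i Kz; have := cell_index_dist y i (h0 k).
  set z := (h k *: lattice_point (cell_index (h k) y)) 0 i => zy zB; have := h1 k.
  have := ler_normB z (z - y 0 i); rewrite subKr -natr1.
  by lra.
have intC k m : (lebesgue_rV n).-integrable setT (fun y => (\1_(cell (h k) m) y)%:E).
  apply: integrable_indic_fin; first exact: measurable_cell.
  by have /= -> := lebesgue_cell m (h0 k); rewrite ltry.
have gsum k y : (g k y)%:E = (\sum_(m <- grid K k)
    (f (h k *: lattice_point m))%:E * (\1_(cell (h k) m) y)%:E)%E.
  by rewrite /g -sumEFin.
have mg k : measurable_fun setT (fun y => (g k y)%:E).
  under eq_fun do rewrite gsum.
  apply: emeasurable_sum => m; apply: measurable_funeM.
  by apply/measurable_EFinP; apply: measurable_indic; exact: measurable_cell.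
have int_g k : (\int[lebesgue_rV n]_y (g k y)%:E =
    (h k ^+ n * \sum_(m <- grid K k) f (h k *: lattice_point m))%:E)%E.
  under eq_integral do rewrite gsum.
  rewrite integral_sum//; last by move=> m; exact: integrableZl.
  rewrite mulr_sumr -sumEFin; apply: eq_bigr => m _.
  rewrite integralZl//= integral_indic//; last exact: measurable_cell.
  by rewrite setIT; have /= -> := lebesgue_cell m (h0 k); rewrite -EFinM mulrC.
have := @dominated_convergence _ _ _ (lebesgue_rV n) setT measurableT
  (fun k y => (g k y)%:E) ((fun y => (f y)%:E) \_ K) (fun y => (`|C| * \1_Q y)%:E) mg.
case.
- apply/(measurable_restrictT _ mK); apply: measurable_funTS.
  by apply/measurable_EFinP.
- exists (K `\` interior K); split => //.
    by apply: measurableD => //; exact: interior_rV_measurable.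
  move=> y /= ncvg; apply: contrapT => nD; apply: ncvg => _.
  suff [c -> gc] : exists2 c, ((fun y => (f y)%:E) \_ K) y = c%:E & g k y @[k --> \oo] --> c.
    by apply: cvg_EFin => //; near=> k.
  have hlt (r : R) : 0 < r -> \forall k \near \oo, h k < r.
    by move=> r0; have := near_infty_natSinv_lt (PosNum r0).
  have near_y k (r : R) : h k < r -> forall i,
      `|(h k *: lattice_point (cell_index (h k) y)) 0 i - y 0 i| < r.
    by move=> hr i; apply: le_lt_trans hr; exact: cell_index_dist.
  have [Ky|nKy] := pselect (K y).
    have /interior_rVP[r r0 rK] : interior K y by apply: contrapT => nI; exact: nD.
    exists (f y); first by rewrite patchE mem_set.
    apply/cvgrPdist_lt => e e0; have [r' r'0 r'f] := fcont y e e0.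
    near=> k; rewrite gE/= asboolT; last by apply: rK; apply: near_y; near: k; exact: hlt.
    by rewrite distrC; apply: r'f; apply: near_y; near: k; exact: hlt.
  have [r r0 rK] := closed_rVP (compact_rV_closed cK) nKy.
  exists 0; first by rewrite patchE memNset.
  apply: cvg_near_cst; near=> k; rewrite gE/= asboolF//.
  by apply: rK; apply: near_y; near: k; exact: hlt.
- under eq_fun do rewrite EFinM; apply: integrableZl => //.
  exact: integrable_indic_fin.
- by apply/aeW => y k _; rewrite /= lee_fin.
move=> int_f _ int_cvg.
have fin_f := integrable_fin_num measurableT int_f.
rewrite /Rintegral integral_mkcond.
have -> : (fun k => k.+1%:R ^- n * \sum_(m <- grid K k) f (k.+1%:R^-1 *: lattice_point m))
    = fine \o (fun k => \int[lebesgue_rV n]_y (g k y)%:E)%E.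
  by apply/funext => k; rewrite /= int_g/= exprVn.
by apply: fine_cvg; rewrite fineK.
Unshelve. all: end_near.
Qed.

End riemann_sums.

(** * Convexity and the lattice-free interior *)

Lemma convex_average {R : realType} {n : nat} (K : set 'rV[R]_n) (s : seq 'rV[R]_n) :
  convex_set K -> (forall x, x \in s -> K x) -> (0 < size s)%N ->
  K ((size s)%:R^-1 *: \sum_(x <- s) x).
Proof.
move=> cK; elim: s => [//|x s IH] Ks _.
have Kx : K x by apply: Ks; rewrite mem_head.
case: s IH Ks => [_ _|y s IH Ks]; first by rewrite big_seq1 invr1 scale1r.
set t := y :: s in IH Ks *.
have {IH}Kt : K ((size t)%:R^-1 *: \sum_(x <- t) x).
  by apply: IH => // z zt; apply: Ks; rewrite inE zt orbT.
have st : (0 : R) < (size t)%:R by rewrite ltr0n.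
have -> : (size (x :: t))%:R^-1 *: \sum_(x <- x :: t) x = (size t).+1%:R^-1 *: x
    + (1 - (size t).+1%:R^-1) *: ((size t)%:R^-1 *: \sum_(x <- t) x) :> 'rV[R]_n.
  rewrite big_cons scalerDr scalerA; congr (_ *: _ + _ *: _).
  rewrite -[size (x :: t)]/(size t).+1 -natr1; move: ((size t)%:R : R) st => q q0.
  by field; rewrite !gt_eqF// addr_gt0.
apply: (convex_rVP cK Kx Kt).
by rewrite invr_ge0 ler0n invf_le1 ?ler1n ?ltr0n.
Qed.

Section grid_bound.
Context {R : realType} {n : nat}.
Variables (K : set 'rV[R]_n) (r e : R) (k : nat).
Hypotheses (cK : compact K) (convK : convex_set K).
Hypotheses (r0 : 0 < r) (rK : forall y : 'rV[R]_n, (forall i, `|y 0 i| < r) -> interior K y).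
Hypothesis K_lattice : interior K `&` integer_points R n = [set 0].
Hypothesis e0 : 0 < e.

Let M := k.+1%:R : R.
Let N := size (grid K k).
Hypothesis N0 : (0 < N)%N.
Hypothesis small_sum : forall i, `|(\sum_(m <- grid K k) m 0 i)%:~R| < r * e * (N%:R * M).

(** This is where the position of [K] enters. If a sum of [a N] points of the
    grid is congruent modulo [p] to [a] times the sum of all the points, the
    quotient [z] of the difference by [p] is [t y] plus a small multiple of
    the sum of the grid, where [y] is in [K] and [t < 1]. The smallness of
    that sum, which comes from the barycenter being 0, puts [z] in the
    interior of [K], so [z] is 0. *)
Lemma grid_rigid (a p : nat) (z : 'rV[int]_n) (s : seq 'rV[int]_n) :
  (0 < a)%N -> a%:R * (N%:R * M) * (1 + e) <= p%:R ->
  size s = (a * N)%N -> (forall m, m \in s -> m \in grid K k) ->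
  \sum_(m <- s) m = (\sum_(m <- grid K k) m) *+ a + z *+ p -> z = 0.
Proof.
move=> a0 ap size_s sK sz.
have M0 : 0 < M by rewrite ltr0n.
have NR0 : 0 < N%:R :> R by rewrite ltr0n.
have aR0 : 0 < a%:R :> R by rewrite ltr0n.
pose aNM := a%:R * (N%:R * M).
have aNM0 : 0 < aNM by rewrite !mulr_gt0.
have p0 : 0 < p%:R :> R by apply: lt_le_trans ap; rewrite mulr_gt0// addr_gt0.
pose t := aNM / p%:R.
have t0 : 0 < t by rewrite divr_gt0.
have te : t * (1 + e) <= 1 by rewrite /t mulrAC ler_pdivrMr// mul1r.
have te0 : 0 < t * e by rewrite mulr_gt0.
have t1 : 0 < 1 - t by lra.
pose y : 'rV[R]_n := (size s)%:R^-1 *: \sum_(x <- [seq M^-1 *: lattice_point m | m <- s]) x.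
have Ky : K y.
  rewrite /y -(size_map (fun m => M^-1 *: lattice_point m : 'rV[R]_n)).
  apply: convex_average => //; last by rewrite size_map size_s muln_gt0 a0.
  by move=> _ /mapP[m /sK + ->]; rewrite mem_grid// => /asboolP.
have [c [c0 cE]] : exists c : R, 0 < c /\ (1 - t) * c = a%:R / p%:R.
  exists (a%:R / p%:R / (1 - t)); split; last by rewrite mulrC divfK ?gt_eqF.
  by do 2?apply: divr_gt0.
have cNM : c * (N%:R * M) * (1 - t) = t.
  have -> : c * (N%:R * M) * (1 - t) = (1 - t) * c * (N%:R * M) by ring.
  by rewrite cE /t /aNM; field; rewrite gt_eqF.
have ce : c * (N%:R * M) * e <= 1.
  rewrite -(ler_pM2r t1) mulrAC cNM mul1r; lra.
pose w : 'rV[R]_n := - (c *: lattice_point (\sum_(m <- grid K k) m)).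
have Iw : interior K w.
  apply: rK => i; rewrite !mxE summxE normrN normrM (gtr0_norm c0).
  have H : c * `|(\sum_(m <- grid K k) m 0 i)%:~R| < c * (r * e * (N%:R * M)).
    by rewrite ltr_pM2l.
  apply: lt_le_trans H _.
  have -> : c * (r * e * (N%:R * M)) = r * (c * (N%:R * M) * e) by ring.
  by rewrite ger_pMr.
have := convex_interior convK Ky Iw (t := t).
rewrite (ltW t0) -subr_gt0 t1 => /(_ isT).
have -> : t *: y + (1 - t) *: w = lattice_point z.
  apply/rowP => i; have /rowP/(_ i) := sz; rewrite !mxE !summxE big_map.
  move=> /(congr1 (fun x : int => x%:~R : R)); rewrite !mulmxnE !summxE rmorphD/= !rmorphMn/= => E.
  under eq_bigr do rewrite !mxE.
  rewrite -mulr_sumr -rmorph_sum/= E size_s natrM mulrN [(1 - t) * _]mulrA cE /t /aNM.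
  by field; rewrite !gt_eqF.
move=> Iz; have : [set 0 : 'rV[R]_n] (lattice_point z) by rewrite -K_lattice; split => //; exists z.
move=> /= /rowP zE; apply/rowP => i; have := zE i; rewrite !mxE.
by move=> /eqP; rewrite intr_eq0 => /eqP.
Qed.

(** With [p] large compared with the grid, [a] is chosen as the integer part
    of [p / ((1 + e) N M)]: large enough for [n (p - 1) / a] to be at most [n
    (1 + e) ^ 2 N M], small enough for [grid_rigid] to apply. *)
Lemma grid_bound (u : 'rV[int]_n) (i0 : 'I_n) (A : int) (L E : nat) :
  u 0 i0 != 0 ->
  (forall m, m \in grid K k -> A <= \sum_i u 0 i * m 0 i <= A + L%:Z) ->
  ((L.+1 + E) * N + 'C(n + E, n.+1))%:R
    <= n%:R * (1 + e) ^+ 2 * (N%:R * M) + 'C(n + (L.+1 + E), n.+1)%:R.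
Proof.
move=> ui0 uA.
have M0 : 0 < M by rewrite ltr0n.
have NR0 : 0 < N%:R :> R by rewrite ltr0n.
have NM0 : 0 < N%:R * M by rewrite mulr_gt0.
have e10 : 0 < 1 + e by rewrite addr_gt0.
have ie0 : 0 < e^-1 by rewrite invr_gt0.
have [B KB] := compact_rV_bounded cK.
have gridB m i : m \in grid K k -> (absz (m 0%R i) <= B * k.+1)%N.
  rewrite mem_grid// => /asboolP/(KB _ i); rewrite !mxE normrM ger0_norm ?invr_ge0//.
  by rewrite mulrC ler_pdivrMr// -intr_norm -abszE -pmulrn -natrM ler_nat.
(* [p] exceeds the coefficient [u 0 i0] and the differences of coordinates of
   grid points, so that these are not lost modulo [p]; it also makes [a e >=
   1]. *)
have [p p_big p_pr] := prime_above (maxn (absz (u 0%R i0))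
  (maxn (2 * (B * k.+1)) (Num.bound ((1 + e^-1) * ((1 + e) * (N%:R * M)))))).
move: p_big; rewrite !gtn_max => /and3P[p_u p_B p_e].
have p0 : 0 < p%:R :> R by rewrite ltr0n prime_gt0.
pose q := p%:R / ((1 + e) * (N%:R * M)).
have q0 : 0 <= q by rewrite divr_ge0 ?ltW// mulr_gt0.
have q1 : 1 + e^-1 <= q.
  rewrite ler_pdivlMr ?mulr_gt0//; apply: le_trans (ltW (archi_boundP _)) _.
    exact: ltW (mulr_gt0 (addr_gt0 ltr01 ie0) (mulr_gt0 e10 NM0)).
  by rewrite ler_nat ltnW.
pose a := Num.truncn q.
have aq : a%:R <= q by rewrite truncn_le.
have qa : q < a%:R + 1 by rewrite natr1 -truncn_le_nat.
have ae : 1 <= a%:R * e by rewrite -ler_pdivrMr// mul1r; lra.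
have a0 : (0 < a)%N by rewrite lt0n; apply: contraTneq ae => ->; rewrite mul0r ler10.
have qE : q * ((1 + e) * (N%:R * M)) = p%:R by rewrite divfK// gt_eqF// mulr_gt0.
have ap : a%:R * (N%:R * M) * (1 + e) <= p%:R.
  by rewrite -qE -mulrA [N%:R * M * _]mulrC ler_pM2r// mulr_gt0.
have pa : p%:R <= a%:R * ((1 + e) ^+ 2 * (N%:R * M)).
  have -> : a%:R * ((1 + e) ^+ 2 * (N%:R * M)) = a%:R * (1 + e) * ((1 + e) * (N%:R * M)).
    by ring.
  rewrite -qE ler_pM2r ?mulr_gt0//.
  apply: le_trans (ltW qa) _; lra.
have Fp0 (d : int) : (d%:~R == 0 :> 'F_p) = (p %| d)%Z.
  by rewrite -(dvdz_pcharf (pchar_Fp p_pr)).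
have small_dvd (d : int) : (p %| d)%Z -> (absz d < p)%N -> d = 0.
  rewrite dvdzE/= => pd dp; apply/eqP; rewrite -absz_eq0; apply: contraLR pd => d0.
  by apply/negP => /(dvdn_leq _); rewrite lt0n d0 => /(_ isT); rewrite leqNgt dp.
pose m (v : 'I_N) : 'rV[int]_n := tnth (in_tuple (grid K k)) v.
have mgrid v : m v \in grid K k by exact: mem_tnth.
have sum_m (V : nmodType) (h : 'rV[int]_n -> V) :
    \sum_v h (m v) = \sum_(x <- grid K k) h x.
  by rewrite [RHS]big_tnth.
have mI : injective m by apply/tuple_uniqP; exact: grid_uniq.
have xI : injective (fun v => map_mx intr (m v) : 'rV['F_p]_n).
  move=> v w /rowP vw; apply: mI; apply/rowP => i; apply/eqP; rewrite -subr_eq0.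
  apply/eqP/small_dvd; first by rewrite -Fp0 rmorphB subr_eq0/=; have := vw i; rewrite !mxE => ->.
  move: p_B (gridB _ i (mgrid v)) (gridB _ i (mgrid w)).
  by move: (m v 0%R i) (m w 0%R i) (B * k.+1)%N => b c D; clear; lia.
have up : (u 0 i0)%:~R != 0 :> 'F_p.
  by rewrite Fp0; apply: contra ui0 => /small_dvd ->.
have rigid (s : seq 'I_N) : size s = (a * #|'I_N|)%N ->
    \sum_(w <- s) map_mx intr (m w) = (\sum_v map_mx intr (m v)) *+ a :> 'rV['F_p]_n ->
    \sum_(w <- s) m w = (\sum_v m v) *+ a.
  rewrite card_ord => size_s sE.
  pose d := \sum_(w <- s) m w - (\sum_v m v) *+ a.
  have dp i : (p %| d 0%R i)%Z.
    have /rowP/(_ i) := sE; rewrite mulmxnE !summxE => sEi.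
    rewrite -Fp0 /d mxE [X in _ + X]mxE mulmxnE !summxE rmorphB rmorphMn/= !rmorph_sum/= subr_eq0.
    have E1 w : (m w 0 i)%:~R = (map_mx intr (m w) : 'rV['F_p]_n) 0 i by rewrite mxE.
    apply/eqP; rewrite (eq_bigr _ (fun w _ => E1 w)) sEi.
    by rewrite [in RHS](eq_bigr _ (fun w _ => E1 w)).
  pose z := \row_i (d 0%R i %/ p)%Z : 'rV[int]_n.
  have dz : d = z *+ p.
    by apply/rowP => i; rewrite mulmxnE [z 0 i]mxE -mulr_natr natz divzK.
  have sE' : \sum_(w <- s) m w = (\sum_(x <- grid K k) x) *+ a + z *+ p.
    by rewrite -dz /d (sum_m _ id) addrC subrK.
  have z0 : z = 0.
    apply: (grid_rigid a0 ap (s := map m s)); rewrite ?size_map//.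
    - by move=> _ /mapP[w _ ->].
    - by rewrite big_map.
  by rewrite sE' z0 mul0rn addr0 (sum_m _ id).
have := lattice_points_bound E p_pr mI xI up (fun v => uA _ (mgrid v)) rigid.
rewrite card_ord -(ler_nat R) natrD !natrM => H.
rewrite -(ler_pM2l (_ : 0 < a%:R)) ?ltr0n// mulrDr.
apply: le_trans H _; rewrite lerD2r.
have pn : n%:R * p.-1%:R <= n%:R * p%:R :> R by rewrite ler_wpM2l// ler_nat leq_pred.
apply: le_trans pn _.
have -> : a%:R * (n%:R * (1 + e) ^+ 2 * (N%:R * M)) =
  n%:R * (a%:R * ((1 + e) ^+ 2 * (N%:R * M))) by ring.
by rewrite ler_wpM2l.
Qed.

End grid_bound.

(** * Passing to the limit *)

Lemma bin_le_expn n m : ('C(n + m, n.+1) * (n.+1)`! <= (n + m) ^ n.+1)%N.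
Proof.
rewrite bin_ffact; move: (n + m)%N n.+1 => a b {m n}.
elim: b a => [|b IH] a; first by rewrite ffactn0.
rewrite ffactnS expnS leq_mul2l (leq_trans (IH _)) ?orbT//.
by case: b {IH} => // b; rewrite leq_exp2r// leq_pred.
Qed.

Lemma expn_le_bin n m : (m ^ n.+1 <= 'C(n + m, n.+1) * (n.+1)`!)%N.
Proof.
rewrite bin_ffact; elim: n => [|n IH]; first by rewrite add0n ffactn1 expn1.
by rewrite addSn ffactSS expnS leq_mul// leqW// leq_addl.
Qed.

Lemma cvg_eventually_le {R : realType} (f g : nat -> R) (a b : R) :
  f k @[k --> \oo] --> a -> g k @[k --> \oo] --> b ->
  (\forall k \near \oo, f k <= g k) -> a <= b.
Proof.
move=> fa gb fg; rewrite -(cvg_lim _ fa)// -(cvg_lim _ gb)//.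
by apply: ler_lim fg; [exact: cvgP fa|exact: cvgP gb].
Qed.

Section width_bound.
Context {R : realType} {n : nat}.
Variables (K : set 'rV[R]_n).
Hypotheses (cK : compact K) (convK : convex_set K).
Hypothesis K_lattice : interior K `&` integer_points R n = [set 0].

Let K0 : interior K 0.
Proof. by have : [set 0 : 'rV[R]_n] 0 by []; rewrite -K_lattice => -[]. Qed.

Let mK : measurable K := closed_rV_measurable (compact_rV_closed cK).
Let bd0 := convex_boundary_null cK convK K0.

Lemma grid_volume : (size (grid K k))%:R / k.+1%:R ^+ n @[k --> \oo]
  --> fine (lebesgue_rV n K).
Proof.
have fC (y : 'rV[R]_n) : K y -> `|1 : R| <= 1 by rewrite normr1.
have fcont (y : 'rV[R]_n) (e : R) : 0 < e -> exists2 r : R, 0 < r &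
    forall z : 'rV[R]_n, (forall i, `|z 0 i - y 0 i| < r) -> `|1 - 1 : R| < e.
  by move=> e0; exists 1 => // z _; rewrite subrr normr0.
have := riemann_sum_cvg (f := fun=> 1) cK bd0 (measurable_cst _) fC fcont.
rewrite Rintegral_cst// mul1r.
by under eq_fun do rewrite big_const_seq count_predT iter_addr_0 mulrC.
Qed.

Lemma grid_moment i : (\sum_(m <- grid K k) m 0 i)%:~R / k.+1%:R ^+ n.+1 @[k --> \oo]
  --> \int[lebesgue_rV n]_(y in K) (y 0 i).
Proof.
have [B KB] := compact_rV_bounded cK.
have fC (y : 'rV[R]_n) : K y -> `|y 0 i| <= B%:R by exact: KB.
have fcont (y : 'rV[R]_n) (e : R) : 0 < e -> exists2 r : R, 0 < r &
    forall z : 'rV[R]_n, (forall i, `|z 0 i - y 0 i| < r) -> `|z 0 i - y 0 i| < e.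
  by move=> e0; exists e.
have -> : (fun k => (\sum_(m <- grid K k) m 0 i)%:~R / k.+1%:R ^+ n.+1 : R) =
    (fun k => k.+1%:R ^- n * (\sum_(m <- grid K k) (k.+1%:R^-1 *: lattice_point m) 0 i)).
  apply/funext => k; under [in RHS]eq_bigr do rewrite !mxE.
  by rewrite -mulr_sumr rmorph_sum/= exprS invfM; ring.
exact: riemann_sum_cvg cK bd0 (measurable_coord i) fC fcont.
Qed.

Lemma pairing_bounded (u : 'rV[int]_n) : exists D : R, forall x, K x -> `|pairing u x| <= D.
Proof.
have [B KB] := compact_rV_bounded cK.
exists (\sum_i `|(u 0 i)%:~R| * B%:R) => x Kx.
apply: le_trans (ler_norm_sum _ _ _) _; apply: ler_sum => i _.
by rewrite normrM ler_wpM2l// KB.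
Qed.

Lemma pairing_between (u : 'rV[int]_n) x : K x ->
  inf [set pairing u x | x in K] <= pairing u x
    <= inf [set pairing u x | x in K] + lattice_width u K.
Proof.
move=> Kx; have [D uD] := pairing_bounded u; apply/andP; split.
  apply: ge_inf; last by exists x.
  by exists (- D) => _ [y /uD + <-]; rewrite ler_norml => /andP[].
rewrite /lattice_width addrC subrK; apply: ub_le_sup; last by exists x.
by exists D => _ [y /uD + <-]; rewrite ler_norml => /andP[].
Qed.

Lemma lattice_width_ge0 (u : 'rV[int]_n) : 0 <= lattice_width u K.
Proof.
have /(pairing_between u)/andP[] := interior_subset K0.
by move=> /le_trans H /H; rewrite lerDl.
Qed.

Hypothesis moment0 : forall i, \int[lebesgue_rV n]_(y in K) (y 0 i) = 0.
Hypothesis vol_gt0 : 0 < fine (lebesgue_rV n K).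

(** [grid_bound] for the grid of mesh [1 / M], with [L] the integer part of [M
    w] and [L + 1 + E = (n + 1) M], divided by [M ^ (n + 1)] in the limit of
    [M] tending to infinity. *)
Lemma width_volume_eps (u : 'rV[int]_n) (e : R) : u != 0 -> 0 < e ->
  lattice_width u K < n.+1%:R ->
  n.+1%:R * fine (lebesgue_rV n K)
      + (n.+1%:R - lattice_width u K) ^+ n.+1 / (n.+1)`!%:R
    <= n%:R * (1 + e) ^+ 2 * fine (lebesgue_rV n K) + n.+1%:R ^+ n.+1 / (n.+1)`!%:R.
Proof.
move=> u0 e0; set w := lattice_width u K => wn.
have w0 : 0 <= w := lattice_width_ge0 u.
have [i0 ui0] : exists i, u 0 i != 0.
  apply: contrapT => /forallNP H; move/eqP: u0; apply; apply/rowP => i.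
  by have /negP := H i; rewrite negbK mxE => /eqP.
have /interior_rVP[r r0 rK] : interior (interior K) 0.
  by have := open_interior K; rewrite openE; apply.
have {}rK (y : 'rV[R]_n) : (forall i, `|y 0 i| < r) -> interior K y.
  by move=> yr; apply: rK => i; rewrite mxE subr0.
pose h (k : nat) : R := k.+1%:R^-1.
have h0 : h k @[k --> \oo] --> 0 := cvg_harmonic.
pose nu k : R := (size (grid K k))%:R / k.+1%:R ^+ n.
have nuV : nu k @[k --> \oo] --> fine (lebesgue_rV n K) := grid_volume.
have cstc (c : R) : (fun _ : nat => c) @ \oo --> c by exact: cvg_cst.
have pow (f : nat -> R) (c : R) : f k @[k --> \oo] --> c -> f k ^+ n.+1 @[k --> \oo] --> c ^+ n.+1.
  move=> fc; apply: (@continuous_cvg _ R R \oo _ f (fun x => x ^+ n.+1) c) => //.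
  exact: exprn_continuous.
have F0 : (0 : R) < (n.+1)`!%:R by rewrite ltr0n fact_gt0.
apply: (@cvg_eventually_le R
  (fun k => n.+1%:R * nu k + (n.+1%:R - w - h k) ^+ n.+1 / (n.+1)`!%:R)
  (fun k => n%:R * (1 + e) ^+ 2 * nu k + (n.+1%:R + n%:R * h k) ^+ n.+1 / (n.+1)`!%:R)).
- apply: cvgD; first exact: cvgM.
  apply: cvgM => //; apply: pow; rewrite -[X in _ --> X]subr0.
  exact: cvgB.
- apply: cvgD; first exact: cvgM.
  apply: cvgM => //; apply: pow; rewrite -[X in _ --> X]addr0 -(mulr0 n%:R).
  by apply: cvgD => //; exact: cvgM.
have small i : \forall k \near \oo,
    `|(\sum_(m <- grid K k) m 0 i)%:~R| < r * e * ((size (grid K k))%:R * k.+1%:R).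
  have := @grid_moment i; rewrite moment0 => mom0.
  have c0 : 0 < r * e * (fine (lebesgue_rV n K) / 2) by rewrite !mulr_gt0// invr_gt0.
  have V2 : 0 < fine (lebesgue_rV n K) / 2 by rewrite divr_gt0.
  move/cvgrPdist_lt : mom0 => /(_ _ c0) near1.
  move/cvgrPdist_lt : nuV => /(_ _ V2) near2.
  near=> k.
  have k0 : 0 < k.+1%:R ^+ n.+1 :> R by rewrite exprn_gt0.
  have m1 : `|0 - (\sum_(m <- grid K k) m 0 i)%:~R / k.+1%:R ^+ n.+1|
      < r * e * (fine (lebesgue_rV n K) / 2) by near: k.
  have m2 : `|fine (lebesgue_rV n K) - nu k| < fine (lebesgue_rV n K) / 2 by near: k.
  rewrite sub0r normrN normrM [`|_^-1|]gtr0_norm ?invr_gt0// in m1.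
  have nu2 : fine (lebesgue_rV n K) / 2 < nu k.
    by move: m2; rewrite ltr_norml; lra.
  have -> : r * e * ((size (grid K k))%:R * k.+1%:R) = r * e * nu k * k.+1%:R ^+ n.+1.
    by rewrite /nu exprS; field; rewrite expf_neq0// pnatr_eq0.
  rewrite -ltr_pdivrMr//; apply: lt_trans m1 _; rewrite ltr_pM2l// mulr_gt0//.
have small_all : \forall k \near \oo, forall i,
    `|(\sum_(m <- grid K k) m 0 i)%:~R| < r * e * ((size (grid K k))%:R * k.+1%:R).
  exact: filter_forall.
have hsmall : \forall k \near \oo, h k < n.+1%:R - w.
  have d0 : 0 < n.+1%:R - w by rewrite subr_gt0.
  exact: (near_infty_natSinv_lt (PosNum d0)).
have nu_gt0 : \forall k \near \oo, 0 < nu k.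
  by move/cvgr_gt : nuV; apply.
near=> k.
pose M : R := k.+1%:R.
have M0 : 0 < M by rewrite ltr0n.
have hM : h k * M = 1 by rewrite mulVf// gt_eqF.
have hk : h k < n.+1%:R - w by near: k.
have nuk : 0 < nu k by near: k.
have smallk : forall i, `|(\sum_(m <- grid K k) m 0 i)%:~R| < r * e * ((size (grid K k))%:R * k.+1%:R).
  by near: k.
have N0 : (0 < size (grid K k))%N.
  by rewrite lt0n; apply: contraTneq nuk; rewrite /nu => ->; rewrite mul0r ltxx.
set N := size (grid K k) in N0 smallk *.
pose L := Num.truncn (M * w).
have Mw0 : 0 <= M * w by rewrite mulr_ge0// ltW.
have LMw : L%:R <= M * w by rewrite truncn_le.
have LE : (L.+1 <= n.+1 * k.+1)%N.
  have H : L%:R + 1 <= n.+1%:R * M.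
    have H0 : (h k + w) * M <= n.+1%:R * M by rewrite ler_pM2r// ltW// -ltrBrDr.
    apply: le_trans H0; rewrite mulrDl hM addrC lerD2l mulrC.
    exact: LMw.
  by rewrite -(ler_nat R) -natr1 natrM.
pose E := (n.+1 * k.+1 - L.+1)%N.
have LEE : (L.+1 + E = n.+1 * k.+1)%N by rewrite subnKC.
pose low := inf [set pairing u x | x in K].
pose A := Num.ceil (M * low).
have uA m : m \in grid K k -> A <= \sum_i u 0 i * m 0 i <= A + L%:Z.
  rewrite mem_grid// => /asboolP/(pairing_between u); rewrite -/low -/w.
  have -> : pairing u (k.+1%:R^-1 *: lattice_point m) = (\sum_i u 0 i * m 0 i)%:~R / M.
    rewrite /pairing rmorph_sum/= mulr_suml; apply: eq_bigr => i _.
    by rewrite !mxE rmorphM/= -mulrA; congr (_ * _); rewrite mulrC.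
  rewrite ler_pdivlMr// ler_pdivrMr// => /andP[].
  move: (\sum_i _) => S lo hi.
  have -> : A <= S by rewrite /A ceil_le_int mulrC.
  rewrite -lerBlDl/=.
  have H : (S - A)%:~R <= M * w.
    rewrite rmorphB/= lerBlDl; apply: le_trans hi _.
    rewrite mulrDl mulrC (mulrC w) lerD2r; exact: ceil_ge.
  have [neg|pos] := lerP (S - A) 0; first by rewrite (le_trans neg).
  by rewrite -(gez0_abs (ltW pos)) lez_nat truncn_ge_nat// pmulrn gez0_abs// ltW.
have := grid_bound cK convK r0 rK K_lattice e0 N0 smallk E ui0 uA.
rewrite LEE -/M => bound.
have b1 : E%:R ^+ n.+1 / (n.+1)`!%:R <= 'C(n + E, n.+1)%:R :> R.
  by rewrite ler_pdivrMr// -natrX -natrM ler_nat expn_le_bin.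
have b2 : 'C(n + n.+1 * k.+1, n.+1)%:R <= (n + n.+1 * k.+1)%:R ^+ n.+1 / (n.+1)`!%:R :> R.
  by rewrite ler_pdivlMr// -natrX -natrM ler_nat bin_le_expn.
have Mn0 : 0 < M ^+ n.+1 by rewrite exprn_gt0.
rewrite -(ler_pM2r Mn0).
have nuM : nu k * M ^+ n.+1 = N%:R * M.
  by rewrite /nu exprS -/M; field; rewrite expf_neq0// gt_eqF.
have powM (x : R) : x ^+ n.+1 / (n.+1)`!%:R * M ^+ n.+1 = (x * M) ^+ n.+1 / (n.+1)`!%:R.
  by rewrite mulrAC -exprMn.
have -> : (n%:R * (1 + e) ^+ 2 * nu k + (n.+1%:R + n%:R * h k) ^+ n.+1 / (n.+1)`!%:R) * M ^+ n.+1
   = n%:R * (1 + e) ^+ 2 * (N%:R * M) + (n + n.+1 * k.+1)%:R ^+ n.+1 / (n.+1)`!%:R.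
  rewrite mulrDl -mulrA nuM powM; congr (_ + _ ^+ _ / _).
  by rewrite mulrDl -mulrA hM mulr1 natrD natrM addrC.
have -> : (n.+1%:R * nu k + (n.+1%:R - w - h k) ^+ n.+1 / (n.+1)`!%:R) * M ^+ n.+1
   = n.+1%:R * (N%:R * M) + (n.+1%:R * M - M * w - 1) ^+ n.+1 / (n.+1)`!%:R.
  rewrite mulrDl -mulrA nuM powM; congr (_ + _ ^+ _ / _).
  by rewrite mulrBl hM mulrBl (mulrC w).
apply: le_trans (_ : _ <= n%:R * (1 + e) ^+ 2 * (N%:R * M) + 'C(n + n.+1 * k.+1, n.+1)%:R) _.
  apply: le_trans bound.
  have -> : (n.+1 * k.+1 * N + 'C(n + E, n.+1))%:R =
      n.+1%:R * (N%:R * M) + 'C(n + E, n.+1)%:R by rewrite natrD !natrM /M; ring.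
  rewrite lerD2l.
  apply: le_trans b1; rewrite ler_pM2r ?invr_gt0// lerXn2r ?nnegrE//.
    have H0 : h k * M <= (n.+1%:R - w) * M by rewrite ler_pM2r// ltW.
    by move: H0; rewrite hM mulrBl (mulrC w); lra.
  by rewrite /E natrB// natrM -natr1 -/M; lra.
by rewrite lerD2l.
Unshelve. all: end_near.
Qed.

End width_bound.

(** For the extremal volume the terms of [width_volume_eps] that do not
    involve the width cancel as [e] tends to 0, and a width less than [n + 1]
    leaves a positive term on the left. *)
Lemma extremal_volume_width {R : realType} {n : nat} (K : set 'rV[R]_n) (u : 'rV[int]_n) :
  compact K -> convex_set K -> interior K `&` integer_points R n = [set 0] ->
  (forall i, \int[lebesgue_rV n]_(y in K) (y 0 i) = 0) ->
  fine (lebesgue_rV n K) = (n.+1 ^ n)%:R / (n`!)%:R ->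
  u != 0 -> n.+1%:R <= lattice_width u K.
Proof.
move=> cK convK KZ mom0 volK u0; rewrite leNgt; apply/negP => wn.
have F0 m : (0 : R) < m`!%:R by rewrite ltr0n fact_gt0.
have V0 : 0 < fine (lebesgue_rV n K) by rewrite volK divr_gt0// ltr0n expn_gt0.
have VE : n.+1%:R ^+ n.+1 / (n.+1)`!%:R = fine (lebesgue_rV n K).
  rewrite volK natrX factS natrM exprS; field.
  by rewrite gt_eqF//= addrC natr1 pnatr_eq0.
have bound e := width_volume_eps cK convK KZ mom0 V0 (e := e) u0.
move: (fine _) V0 VE bound => V V0 -> bound.
set c := (_ - _) ^+ _ / _ in bound.
have c0 : 0 < c by rewrite divr_gt0// exprn_gt0// subr_gt0.
clearbody c.
have nV : 0 <= n%:R * V by rewrite mulr_ge0// ltW.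
have den0 : 0 < c + 3 * (n%:R * V) by lra.
(* Since [(1 + e) ^ 2 <= 1 + 3 e], the gain [c] beats the loss [3 e n V]. *)
have [e [e0 e1 eE]] : exists e : R, [/\ 0 < e, e <= 1 & e * (c + 3 * (n%:R * V)) = c].
  exists (c / (c + 3 * (n%:R * V))); split; first exact: divr_gt0.
    by rewrite ler_pdivrMr//; lra.
  by rewrite divfK ?gt_eqF.
have := bound e e0 wn; rewrite -natr1.
have ec : 0 < e * c by rewrite mulr_gt0.
have e2 : (1 + e) ^+ 2 <= 1 + 3 * e by nra.
have e3 : n%:R * V * (1 + e) ^+ 2 <= n%:R * V * (1 + 3 * e) by rewrite ler_wpM2l.
nra.
Qed.

(** * The centered simplex and the theorem *)

Section simplex.
Context {R : realType} {n : nat}.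
Implicit Types (u : 'rV[int]_n).

Lemma pairingB u (c : R) (x y : 'rV[R]_n) :
  pairing u (c *: x - y) = c * pairing u x - pairing u y.
Proof.
rewrite /pairing mulr_sumr -sumrB; apply: eq_bigr => i _.
by rewrite !mxE mulrBr mulrCA.
Qed.

Lemma pairing_delta u (i : 'I_n) : pairing u (delta_mx 0 i : 'rV[R]_n) = (u 0 i)%:~R.
Proof.
rewrite /pairing (bigD1 i)//= mxE !eqxx mulr1 big1 ?addr0// => j ji.
by rewrite mxE (negbTE ji) andbF mulr0.
Qed.

Lemma pairing0 u : pairing u (0 : 'rV[R]_n) = 0.
Proof. by rewrite /pairing big1// => i _; rewrite mxE mulr0. Qed.

Lemma simplex0 : standard_simplex (0 : 'rV[R]_n).
Proof. by apply: sub_gen_smallest; left. Qed.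

Lemma simplex_delta (i : 'I_n) : standard_simplex (delta_mx 0 i : 'rV[R]_n).
Proof. by apply: sub_gen_smallest; right; exists i. Qed.

(** The slab between two values of a linear form is convex, so it is enough to
    look at the vertices. *)
Lemma pairing_simplex u (a b : R) (x : 'rV[R]_n) : a <= 0 <= b ->
  (forall i, a <= (u 0 i)%:~R <= b) -> standard_simplex x -> a <= pairing u x <= b.
Proof.
move=> ab uab; pose S : set 'rV[R]_n := [set y | a <= pairing u y <= b].
suff : standard_simplex `<=` S by apply.
have convS : convex_set S.
  move=> y z t; rewrite !inE /S/= => /andP[ay yb] /andP[az zb].
  have -> : pairing u (conv t (y : convex_lmodType 'rV[R]_n) z) =
      t%:num * pairing u y + (1 - t%:num) * pairing u z.
    rewrite /pairing !mulr_sumr -big_split/=; apply: eq_bigr => i _.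
    by rewrite /conv/= !mxE mulrDr !(mulrCA (u 0 i)%:~R).
  have t0 : 0 <= t%:num by [].
  have t1 : 0 <= 1 - t%:num by rewrite subr_ge0.
  by apply/andP; split; nra.
apply: (smallest_sub convS) => y [->|[i _ <-]].
- by rewrite /S/= pairing0.
- by rewrite /S/= pairing_delta.
Qed.

Lemma centered_simplex_pairing u (x : 'rV[R]_n) : standard_simplex x ->
  [set pairing u y | y in centered_simplex R n]
    (n.+1%:R * pairing u x - pairing u (const_mx 1)).
Proof.
move=> Sx; exists (n.+1%:R *: x - const_mx 1); last exact: pairingB.
by exists x.
Qed.

Lemma centered_simplex_between u (a b : R) y : a <= 0 <= b ->
  (forall i, a <= (u 0 i)%:~R <= b) ->
  [set pairing u y | y in centered_simplex R n] y ->
  n.+1%:R * a - pairing u (const_mx 1) <= y <= n.+1%:R * b - pairing u (const_mx 1).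
Proof.
move=> ab uab [_ [x Sx <-] <-]; rewrite pairingB !lerD2r !ler_pM2l ?ltr0n//.
exact: pairing_simplex.
Qed.

Lemma width_centered_simplex_ge u (x y : 'rV[R]_n) :
  standard_simplex x -> standard_simplex y ->
  n.+1%:R * (pairing u x - pairing u y) <= lattice_width u (centered_simplex R n).
Proof.
move=> Sx Sy; pose b : R := \sum_i `|(u 0 i)%:~R|.
have b0 : 0 <= b by exact: sumr_ge0.
have uab i : - b <= (u 0 i)%:~R <= b.
  by rewrite -ler_norml /b (bigD1 i)//= lerDl sumr_ge0.
have ab : - b <= 0 <= b by rewrite oppr_le0 b0.
have between z := @centered_simplex_between u _ _ z ab uab.
have -> : n.+1%:R * (pairing u x - pairing u y) =
  (n.+1%:R * pairing u x - pairing u (const_mx 1))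
    - (n.+1%:R * pairing u y - pairing u (const_mx 1)) by ring.
apply: lerB.
  apply: ub_le_sup; last exact: centered_simplex_pairing.
  by exists (n.+1%:R * b - pairing u (const_mx 1)) => z /between/andP[].
apply: ge_inf; last exact: centered_simplex_pairing.
by exists (n.+1%:R * - b - pairing u (const_mx 1)) => z /between/andP[].
Qed.

Lemma width_centered_simplex_le u (a b : R) : a <= 0 <= b ->
  (forall i, a <= (u 0 i)%:~R <= b) ->
  lattice_width u (centered_simplex R n) <= n.+1%:R * (b - a).
Proof.
move=> ab uab.
have ne : [set pairing u y | y in centered_simplex R n] !=set0.
  by eexists; apply: centered_simplex_pairing; exact: simplex0.
have between z := @centered_simplex_between u _ _ z ab uab.
have -> : n.+1%:R * (b - a) = (n.+1%:R * b - pairing u (const_mx 1))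
    - (n.+1%:R * a - pairing u (const_mx 1)) by ring.
apply: lerB.
  by apply: ge_sup => // z /between/andP[].
by apply: lb_le_inf => // z /between/andP[].
Qed.

End simplex.

Lemma primitive_neq0 n (u : 'rV[int]_n) : primitive u -> exists i, u 0 i != 0.
Proof.
move=> pu; apply: contrapT => /forallNP H; move: pu; rewrite /primitive big1// => i _.
by have /negP := H i; rewrite negbK => /eqP ->.
Qed.

Theorem corollary4p5 (R : realType) (n : nat) (hn : (0 < n)%N) :
  (forall K : set 'rV[R]_n,
     compact K -> convex_set K -> interior K !=set0 ->
     barycenter K = 0 ->
     interior K `&` integer_points R n = [set 0] ->
     lebesgue_rV n K = ((n.+1 ^ n)%:R / (n`!)%:R)%:E ->
     forall u : 'rV[int]_n, primitive u -> n.+1%:R <= lattice_width u K) /\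
  [/\ forall u : 'rV[int]_n,
        primitive u -> n.+1%:R <= lattice_width u (centered_simplex R n),
      forall i : 'I_n,
        lattice_width (delta_mx 0 i) (centered_simplex R n) = n.+1%:R &
      lattice_width (const_mx 1) (centered_simplex R n) = n.+1%:R].
Proof.
have simplex_ge (u : 'rV[int]_n) i : u 0 i != 0 ->
    n.+1%:R <= lattice_width u (centered_simplex R n).
  move=> ui0; have H0 := @simplex0 R n; have Hi := @simplex_delta R n i.
  have n0 : (0 : R) < n.+1%:R by rewrite ltr0n.
  have [neg|pos] := ltP (u 0 i) 0.
    apply: le_trans (width_centered_simplex_ge u H0 Hi).
    rewrite pairing_delta pairing0 sub0r -rmorphN/=; apply: ler_peMr; first exact: ltW.
    by rewrite ler1z; lia.
  apply: le_trans (width_centered_simplex_ge u Hi H0).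
  rewrite pairing_delta pairing0 subr0; apply: ler_peMr; first exact: ltW.
  by rewrite ler1z; lia.
have simplex_le (u : 'rV[int]_n) : (forall i, 0 <= u 0 i <= 1) ->
    lattice_width u (centered_simplex R n) <= n.+1%:R.
  move=> u01; rewrite -[leRHS]mulr1 -[X in _ * X]subr0.
  apply: width_centered_simplex_le => [|i]; first by rewrite lexx ler01.
  by rewrite ler0z lerz1.
split=> [K cK convK _ bar0 KZ volK u pu|].
  have [i ui0] := primitive_neq0 pu.
  apply: extremal_volume_width => //; last by apply: contra_neq ui0 => ->; rewrite mxE.
    move=> j; have /rowP/(_ j) := bar0; rewrite !mxE volK/= => /eqP.
    rewrite mulf_eq0 invr_eq0 mulf_eq0 invr_eq0 !pnatr_eq0 expn_eq0/=.
    by rewrite eqn0Ngt fact_gt0/= => /eqP.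
  by rewrite volK.
split.
- by move=> u /primitive_neq0[i]; exact: simplex_ge.
- move=> i; apply/eqP; rewrite eq_le simplex_le/=; last first.
    by move=> j; rewrite mxE eqxx/=; case: eqP.
  by apply: (simplex_ge _ i); rewrite mxE !eqxx.
- apply/eqP; rewrite eq_le simplex_le/=; last by move=> j; rewrite mxE.
  by apply: (simplex_ge _ (Ordinal hn)); rewrite mxE.
Qed.
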